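(* Let $(a_n,b_n)_{n=1}^\infty$ be a Stoltz sequence of pairs of natural numbers. Each of the following limits holds for $\mu$-almost every $\alpha\in B(0,1)$. (i) For any $z\in Z^*$, $\displaystyle\lim_{n\to\infty}\frac{1}{b_n}\#\big\{1\le j\le b_n:c_{a_n+j}(\alpha)=z\big\}=\frac{1}{|z|^{2m}}$. (ii) $\displaystyle\lim_{n\to\infty}\frac{1}{b_n}\sum_{j=1}^{b_n}\big(-\mathfrak{v}(c_{a_n+j}(\alpha))\big)=\frac{p^f}{(p^f-1)e}$. (iii) For any $l\in\mathbb{N}$, $\displaystyle\lim_{n\to\infty}\frac{1}{b_n}\#\left\{1\le j\le b_n:|c_{a_n+j}(\alpha)|=p^{\frac le}\right\}=\frac{p^f-1}{p^{fl}}$ and $\displaystyle\lim_{n\to\infty}\frac{1}{b_n}\#\left\{1\le j\le b_n:|c_{a_n+j}(\alpha)|\ge p^{\frac le}\right\}=\frac{1}{p^{f(l-1)}}$. (iv) For $k,l\in\mathbb{N}$ with $k<l$, $\displaystyle\lim_{n\to\infty}\frac{1}{b_n}\#\left\{1\le j\le b_n:p^{\frac ke}\le|c_{a_n+j}(\alpha)|<p^{\frac le}\right\}=\frac{1}{p^{f(k-1)}}\left(1-\frac{1}{p^{f(l-k)}}\right)$.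
   Context: $\mathbb{N}$ denotes the positive integers. Let $p$ be a prime and let $K$ be a finite extension of $\mathbb{Q}_p$ of degree $m$, with ramification index $e$ and residue degree $f$ (so $m=ef$). Let $|\cdot|$ be the unique extension to $K$ of the $p$-adic absolute value with $|p|=p^{-1}$, and let $\mathfrak{v}$ be the valuation on $K^*$ with $|x|=p^{-\mathfrak{v}(x)}$. Let $L\subseteq K$ be the unramified subextension of degree $f$ over $\mathbb{Q}_p$, write $L=\mathbb{Q}_p(\gamma)$ with $\gamma$ a primitive $(p^f-1)$-th root of unity, and fix $\beta\in K$ with $K=L(\beta)$ and $|\beta|=p^{1/e}$. Let $X=\{\sum_{j=0}^{k}a_jp^{-j}: k\in\mathbb{N}\cup\{0\},\ a_j\in\{0,1,\dots,p-1\}\}$, $Z=\{\sum_{i=0}^{e-1}\sum_{j=0}^{f-1}b_{i,j}\gamma^j\beta^i: b_{i,j}\in X\}$ and $Z^*=\{c\in Z:|c|>1\}$. For $b=\sum_{j\ge n_0}a_jp^j\in\mathbb{Q}_p$ with digits $a_j\in\{0,1,\dots,p-1\}$ put $\lfloor b\rfloor_p=\sum_{n_0\le j\le 0}a_jp^j$ (which is $0$ if $|b|<1$). Every $\alpha\in K$ is uniquely $\alpha=\sum_{i=0}^{e-1}\sum_{j=0}^{f-1}b_{i,j}\gamma^j\beta^i$ with $b_{i,j}\in\mathbb{Q}_p$, and $\lfloor\alpha\rfloor=\sum_{i=0}^{e-1}\sum_{j=0}^{f-1}\lfloor b_{i,j}\rfloor_p\gamma^j\beta^i$. Let $B(0,1)=\{x\in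 K:|x|<1\}$, and let $\mu$ be the restriction to $B(0,1)$ (with its Borel $\sigma$-algebra) of the Haar measure of the additive group $K$, normalized by $\mu(B(0,1))=1$. The continued fraction map $T:B(0,1)\to B(0,1)$ is $T(\alpha)=\frac1\alpha-\left\lfloor\frac1\alpha\right\rfloor$ for $\alpha\ne 0$ and $T(0)=0$. The $n$-th partial quotient of $\alpha\in B(0,1)$ is $c_n(\alpha)=\lfloor 1/T^{n-1}(\alpha)\rfloor$ for $n\ge 1$, defined when $T^{n-1}(\alpha)\neq 0$ (so all $c_n(\alpha)$ are defined for $\mu$-almost every $\alpha$). Stoltz sequences: for an infinite set $\Omega\subseteq\mathbb{Z}\times\mathbb{N}$, $h\ge 0$, a real $\kappa>0$ and a positive integer $\lambda$, define $\Omega^h=\{(n,k)\in\Omega:k\ge h\}$, $\Omega^h_\kappa=\{(z,s)\in\mathbb{Z}^2:|z-y|<\kappa(s-r)\text{ for some }(y,r)\in\Omega^h\}$, and $\Omega^h_\kappa(\lambda)=\{n:(n,\lambda)\in\Omega^h_\kappa\}$. A sequence of pairs of natural numbers $(a_n,b_n)_{n\ge 1}$ is Stoltz if there exist such an $\Omega$ and a function $h=h(t)$ tending to infinity with $t$ such that $(a_n,b_n)\in\Omega^{h(t)}$ for all $n\ge t$, and there exist $l$, $\kappa>0$ and $A_\kappa>0$ such that $\#\Omega^l_\kappa(\lambda)\le A_\kappa\lambda$ for all positive integers $\lambda$. *)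

(* Defs.v *)
From HB Require Import structures.
From mathcomp Require Import all_boot all_order all_algebra all_field.
From mathcomp Require Import all_classical all_reals all_analysis.

Set Implicit Arguments.
Unset Strict Implicit.
Unset Printing Implicit Defensive.

Import Order.TTheory GRing.Theory Num.Theory.
Import numFieldNormedType.Exports.

Local Open Scope classical_set_scope.
Local Open Scope ring_scope.

Record absvalue (R : realType) (F : fieldType) := AbsValue {
  absval :> F -> R;
  absval_ge0 : forall x, 0 <= absval x;
  absval_eq0 : forall x, absval x = 0 <-> x = 0;
  absvalM : forall x y, absval (x * y) = absval x * absval y;
  absvalD : forall x y, absval (x + y) <= Num.max (absval x) (absval y) }.

(* The field F, with the topology of the absolute value v. *)
Definition valued (R : realType) (F : fieldType) (v : absvalue R F) : Type := F.

Section absvalue_theory.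
Context {R : realType} {F : fieldType} (v : absvalue R F).

Lemma absval0 : v 0 = 0. Proof. exact/absval_eq0. Qed.

Lemma absval1 : v 1 = 1.
Proof.
have v1 : v 1 != 0 by apply/eqP => /absval_eq0/eqP; rewrite oner_eq0.
by apply: (mulfI v1); rewrite -absvalM !mulr1.
Qed.

Lemma absvalN x : v (- x) = v x.
Proof.
have /eqP : v (-1) ^+ 2 = 1 by rewrite expr2 -absvalM mulrNN mulr1 absval1.
rewrite sqrf_eq1 => /orP[] /eqP vN1; first by rewrite -mulN1r absvalM vN1 mul1r.
by have := absval_ge0 v (-1); rewrite vN1 oppr_ge0 ler10.
Qed.

Lemma absvalB x y : v (x - y) = v (y - x).
Proof. by rewrite -absvalN opprB. Qed.


Local Notation Fv := (valued v).

HB.instance Definition _ := GRing.Field.on Fv.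
HB.instance Definition _ := isPointed.Build Fv (0 : F).

Definition vball (x : Fv) (r : R) (y : Fv) : Prop := v (x - y) < r.

Lemma vball_center x (r : R) : 0 < r -> vball x r x.
Proof. by rewrite /vball subrr absval0. Qed.

Lemma vball_sym x y (r : R) : vball x r y -> vball y r x.
Proof. by rewrite /vball absvalB. Qed.

Lemma vball_triangle x y z (r s : R) :
  vball x r y -> vball y s z -> vball x (r + s) z.
Proof.
rewrite /vball => xy yz; rewrite -(subrKA y).
apply: le_lt_trans (absvalD v _ _) _; rewrite gt_max.
have r0 := le_lt_trans (absval_ge0 v (x - y)) xy.
have s0 := le_lt_trans (absval_ge0 v (y - z)) yz.
by rewrite ltr_wpDr ?(ltW s0)// ltr_wpDl ?(ltW r0).
Qed.

Lemma nbhs_vballE : nbhs_ball_ vball = nbhs_ (entourage_ vball).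
Proof.
rewrite /nbhs_ entourage_E predeq2E => x A; split.
  move=> [r r0 rA]; exists [set xy | vball xy.1 r xy.2]; first by exists r.
  by move=> y /xsectionP; exact: rA.
by move=> [E [r r0 rE] EA]; exists r => // y ?; exact/EA/xsectionP/rE.
Qed.

HB.instance Definition _ := hasNbhs.Build Fv (nbhs_ball_ vball).
HB.instance Definition _ := Nbhs_isPseudoMetric.Build R Fv
  nbhs_vballE vball_center vball_sym vball_triangle erefl.

(* F with its Borel sigma-algebra. *)
Definition borel := g_sigma_algebraType (@open Fv).

(* A Radon measure on Borel sets that is invariant under translations. *)
Record is_haar (mu : {measure set borel -> \bar R}) : Prop := IsHaar {
  haar_neq0 : mu [set: F] != 0%E;
  haar_translation : forall (x : F) (A : set borel), measurable A ->
    mu [set x + y | y in (A : set F)] = mu A;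
  haar_compact : forall C : set Fv, compact C -> (mu C < +oo)%E;
  haar_outer_regular : forall A : set borel, measurable A ->
    mu A = ereal_inf [set mu U | U in [set U : set Fv | open U /\ A `<=` U]];
  haar_inner_regular : forall U : set Fv, open U ->
    mu U = ereal_sup [set mu C | C in [set C : set Fv | compact C /\ C `<=` U]]
}.

End absvalue_theory.

Section padic_numbers.
Context {R : realType} (p : nat).

Definition rat_padic_abs (x : rat) : R :=
  if x == 0 then 0
  else p%:R ^ ((logn p `|denq x|)%:Z - (logn p `|numq x|)%:Z).

Section Qp.
Context {Qp : fieldType} (v : absvalue R Qp).

(* (Qp, v) is the completion of the rationals for the p-adic absolute value. *)
Record is_Qp : Prop := IsQp {
  Qp_abs_ratr : forall x : rat, v (ratr x) = rat_padic_abs x;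
  Qp_dense : dense (range (ratr : rat -> valued v));
  Qp_complete : forall G : set_system (valued v),
    ProperFilter G -> cauchy G -> cvg G }.

(* The expansion sum_(j >= -k) a_j p^j of b, with a_j stored as a (j + k);
   an expansion starting at a positive exponent is padded with zeros. *)
Definition padic_expansion (b : Qp) (k : nat) (a : nat -> 'I_p) : Prop :=
  (fun N => \sum_(0 <= i < N) (a i)%:R * p%:R ^ (i%:Z - k%:Z) : valued v)
    @ \oo --> (b : valued v).

Definition padic_floor (b : Qp) : Qp :=
  xget 0 [set y | exists k a, padic_expansion b k a /\
    y = \sum_(0 <= i < k.+1) (a i)%:R * p%:R ^ (i%:Z - k%:Z)].

Definition Xset : set Qp :=
  [set x | exists k (a : nat -> 'I_p),
    x = \sum_(0 <= j < k.+1) (a j)%:R * p%:R ^- j].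

End Qp.
End padic_numbers.

Section extension.
Context {R : realType} {Qp : fieldType} (vQ : absvalue R Qp).
Context {K : fieldExtType Qp} (vK : absvalue R K).

(* e = [|E^*| : |Qp^*|], the t i representing the cosets. *)
Definition ramification_index (E : {subfield K}) (e : nat) : Prop :=
  exists t : 'I_e -> K, (forall i, t i \in E /\ t i != 0) /\
    forall x, x \in E -> x != 0 ->
      exists! i, exists2 a : Qp, a != 0 & vK x = vK (t i) * vQ a.

(* f is the dimension of the residue field of E over that of Qp: the residues
   of the u i form a basis. *)
Definition residue_degree (E : {subfield K}) (f : nat) : Prop :=
  exists u : 'I_f -> K, [/\ forall i, u i \in E /\ vK (u i) <= 1,
    forall x, x \in E -> vK x <= 1 -> exists2 a : 'I_f -> Qp,
      forall i, vQ (a i) <= 1 & vK (x - \sum_i a i *: u i) < 1 &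
    forall a : 'I_f -> Qp, (forall i, vQ (a i) <= 1) ->
      vK (\sum_i a i *: u i) < 1 -> forall i, vQ (a i) < 1].

End extension.

(* vK x = p ^ (- valuation x) for x != 0. *)
Definition valuation (R : realType) (p : nat) (K : fieldType)
    (vK : absvalue R K) (x : K) : R :=
  - (ln (vK x) / ln p%:R).

Section continued_fraction.
Context {R : realType} (p : nat) {Qp : fieldType} (vQ : absvalue R Qp).
Context {K : fieldExtType Qp} (vK : absvalue R K).
Context (e f : nat) (gamma beta : K).

Definition lincomb (b : 'M[Qp]_(e, f)) : K :=
  \sum_(i < e) \sum_(j < f) b i j *: (gamma ^+ j * beta ^+ i).

Definition coordinates (x : K) : 'M[Qp]_(e, f) :=
  xget 0 [set b | lincomb b = x].

Definition floorK (x : K) : K :=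
  lincomb (map_mx (padic_floor p vQ) (coordinates x)).

Definition Zset : set K :=
  [set z | exists2 b : 'M[Qp]_(e, f), (forall i j, Xset p (b i j)) &
    z = lincomb b].

Definition Zstar : set K := [set z | Zset z /\ 1 < vK z].

Definition cfmap (x : K) : K := if x == 0 then 0 else x^-1 - floorK x^-1.

(* The n-th partial quotient, n >= 1.  It is undefined when
   iter n.-1 cfmap x = 0; the value is then floorK 0. *)
Definition partial_quotient (n : nat) (x : K) : K :=
  floorK (iter n.-1 cfmap x)^-1.

End continued_fraction.

Section stoltz.
Context {R : realType}.
Implicit Types (Omega : set (int * nat)) (h kappa : R).

Definition above Omega h : set (int * nat) :=
  [set nk | Omega nk /\ h <= nk.2%:R].

Definition cone Omega h kappa : set (int * int) :=
  [set zs | exists2 yr, above Omega h yr &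
    `|zs.1 - yr.1|%:~R < kappa * (zs.2 - yr.2%:Z)%:~R].

Definition cone_slice Omega h kappa (lambda : nat) : set int :=
  [set n | cone Omega h kappa (n, lambda%:Z)].

(* Sequences are indexed by n >= 1; index 0 is ignored. *)
Definition stoltz (a b : nat -> nat) : Prop :=
  exists Omega, [/\ infinite_set Omega,
    forall nk, Omega nk -> (0 < nk.2)%N,
    exists h : nat -> R, [/\ forall t, 0 <= h t, h @ \oo --> +oo &
      forall t n, (0 < t <= n)%N -> above Omega (h t) ((a n)%:Z, b n)] &
    exists l kappa A : R, [/\ 0 <= l, 0 < kappa, 0 < A &
      forall lambda : nat, (0 < lambda)%N ->
        exists2 k : nat, (cone_slice Omega l kappa lambda #= `I_k)%card &
          k%:R <= A * lambda%:R]].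

(* b^-1 * #{1 <= j <= b : P (a + j)} *)
Definition frequency (P : pred nat) (a b : nat) : R :=
  (count (fun j => P (a + j)%N) (iota 1 b))%:R / b%:R.

End stoltz.

(* Main.v *)
(* Every x in K is uniquely z + y with z in Z and |y| < 1, so the inverse branch
   y |-> 1 / (z + y) maps the unit disk onto a disk and divides distances by
   |z|^2, hence Haar measure by |z|^(2m).  The partial quotients are therefore
   independent, with law P(z) = |z|^(-2m).  Chernoff's inequality makes the
   probability that a window of length r has an average off by more than a given
   epsilon exponentially small in r, while the Stoltz condition bounds the number
   of relevant windows of length r by a multiple of r + 1; Borel-Cantelli
   concludes.  The law of |c_1| is read off from the measure of annuli. *)

From HB Require Import structures.
Require Import Defs.
From mathcomp Require Import all_boot all_order all_algebra all_field.
From mathcomp Require Import all_classical all_reals all_analysis.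
From mathcomp Require Import zify ring lra.
Import Order.TTheory GRing.Theory Num.Theory.
Import numFieldNormedType.Exports.
Set Implicit Arguments.
Unset Strict Implicit.
Unset Printing Implicit Defensive.
Local Open Scope classical_set_scope.
Local Open Scope ring_scope.

(** * Ultrametric absolute values and p-adic expansions *)

(** Uniqueness of z + y rests on an exact norm formula: [lincomb] of b has absolute value max |b_ij|
    |beta|^i. Within a row i the powers of [gamma] are independent modulo elements of absolute value
    below 1, and different rows have absolute values in different cosets of the value group of [Qp],
    so nothing cancels. On the probabilistic side, measurability of the map and of the events is
    bypassed: [cf_bound] asks only for measurable covers, one in each cylinder, with an upper bound
    on their measure. Every estimate is therefore one-sided, and a lower bound is obtained as an
    upper bound for the complementary set of digits or for the opposite function. The weights are
    handled in the same spirit: partial sums over disjoint cylinders are bounded by the measure of a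
    disk or annulus, and two such bounds adding up to 1 replace the evaluation of a series. The
    valuation is unbounded, so its exponential moments have to be controlled; they come from the
    geometric law of the level of a digit. *)

Section ultrametric.
Context {R : realType} {F : fieldType} (v : absvalue R F).

Lemma absval_gt0 x : (0 < v x) = (x != 0).
Proof.
rewrite lt_neqAle absval_ge0 andbT eq_sym; congr (~~ _).
by apply/eqP/eqP => [/absval_eq0|->] //; rewrite absval0.
Qed.

Lemma absvalX x n : v (x ^+ n) = v x ^+ n.
Proof. by elim: n => [|n IHn]; rewrite ?expr0 ?absval1// !exprS absvalM IHn. Qed.

Lemma absvalV x : v x^-1 = (v x)^-1.
Proof.
have [->|x0] := eqVneq x 0; first by rewrite invr0 absval0 invr0.
have vx0 : v x != 0 by rewrite gt_eqF// absval_gt0.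
by apply: (mulfI vx0); rewrite -absvalM !divff// absval1.
Qed.

Lemma absvalXz x (n : int) : v (x ^ n) = v x ^ n.
Proof. by case: n => n; rewrite /exprz ?absvalV absvalX. Qed.

Lemma absvalD_le x y (r : R) : v x <= r -> v y <= r -> v (x + y) <= r.
Proof. by move=> xr yr; apply: le_trans (absvalD v _ _) _; rewrite ge_max xr. Qed.

Lemma absvalD_lt x y (r : R) : v x < r -> v y < r -> v (x + y) < r.
Proof. by move=> xr yr; apply: le_lt_trans (absvalD v _ _) _; rewrite gt_max xr. Qed.

Lemma absvalB_le x y (r : R) : v x <= r -> v y <= r -> v (x - y) <= r.
Proof. by move=> xr yr; apply: absvalD_le => //; rewrite absvalN. Qed.

Lemma absvalB_lt x y (r : R) : v x < r -> v y < r -> v (x - y) < r.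
Proof. by move=> xr yr; apply: absvalD_lt => //; rewrite absvalN. Qed.

Lemma absval_sum_le I (s : seq I) (P : pred I) (E : I -> F) (r : R) :
  0 <= r -> (forall i, P i -> v (E i) <= r) -> v (\sum_(i <- s | P i) E i) <= r.
Proof.
move=> r0 Er; apply: (big_ind (fun x => v x <= r)) => //; first by rewrite absval0.
by move=> x y; apply: absvalD_le.
Qed.

Lemma absval_sum_lt I (s : seq I) (P : pred I) (E : I -> F) (r : R) :
  0 < r -> (forall i, P i -> v (E i) < r) -> v (\sum_(i <- s | P i) E i) < r.
Proof.
move=> r0 Er; apply: (big_ind (fun x => v x < r)) => //; first by rewrite absval0.
by move=> x y; apply: absvalD_lt.
Qed.

Lemma absvalD_eq x y : v y < v x -> v (x + y) = v x.
Proof.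
move=> yx; apply/eqP; rewrite eq_le absvalD_le ?(ltW yx)//=.
rewrite leNgt; apply/negP => xyx.
have : v (x + y - y) < v x by exact: absvalB_lt.
by rewrite addrK ltxx.
Qed.

Lemma absval_close x y : v (x - y) < v x -> v y = v x.
Proof.
move=> xy; rewrite -[in LHS](subKr x y).
by rewrite absvalD_eq// absvalN.
Qed.

Lemma absval_nat_le1 n : v n%:R <= 1.
Proof.
rewrite -[n%:R]/(1 *+ n) -[n](card_ord) -sumr_const.
by apply: absval_sum_le => // i _; rewrite absval1.
Qed.

(** The nonzero terms have pairwise distinct absolute values, so the largest strictly dominates the
    others and cannot be cancelled. *)
Lemma absval_sum_distinct n (E : 'I_n -> F) :
  (forall i j, E i != 0 -> v (E i) = v (E j) -> i = j) ->
  forall i, v (E i) <= v (\sum_j E j).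
Proof.
move=> Einj i.
have [j _ jmax] := @arg_maxP _ _ _ i xpredT (fun k => v (E k)) isT.
have {}jmax k : v (E k) <= v (E j) := jmax k isT.
have [Ej0|Ej0] := eqVneq (E j) 0.
  by apply: le_trans (jmax i) _; rewrite Ej0 absval0 absval_ge0.
rewrite (bigD1 j)//= absvalD_eq; first done.
apply: absval_sum_lt; first by rewrite absval_gt0.
move=> k kj; rewrite lt_neqAle jmax// andbT.
by apply: contraNneq kj => /esym/(Einj _ _ Ej0) ->.
Qed.

End ultrametric.

Section valued_topology.
Context {R : realType} {F : fieldType} (v : absvalue R F).

Lemma open_vball (c : F) (r : R) :
  open ([set x | v (x - c) < r] : set (valued v)).
Proof.
rewrite openE => y /= yc; apply/nbhs_ballP; exists r => /=.
  exact: le_lt_trans (absval_ge0 _ _) yc.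
move=> z; rewrite /ball /= /vball => yz.
by rewrite -(subrKA y); apply: absvalD_lt; rewrite // absvalB.
Qed.

End valued_topology.

Section padic.
Context {R : realType} (p : nat) (p_prime : prime p).
Context {Qp : fieldType} (v : absvalue R Qp) (QpP : is_Qp p v).

Let p1 : (1 < p)%N. Proof. exact: prime_gt1. Qed.
Let pR1 : 1 < p%:R :> R. Proof. by rewrite ltr1n. Qed.
Let pR0 : 0 < p%:R :> R. Proof. by rewrite ltr0n prime_gt0. Qed.

Lemma absval_nat n : (0 < n)%N -> v n%:R = p%:R ^- logn p n.
Proof.
move=> n0; have := Qp_abs_ratr QpP n%:R.
rewrite ratr_nat /rat_padic_abs pnatr_eq0 gtn_eqF// => ->.
by rewrite -[n%:R : rat]/(n%:Z%:~R) numq_int denq_int /= logn1 sub0r exprnN.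
Qed.

Lemma absval_p : v p%:R = p%:R^-1.
Proof. by rewrite absval_nat ?prime_gt0// logn_prime// eqxx expr1. Qed.

Lemma p_neq0 : p%:R != 0 :> Qp.
Proof. by rewrite -(absval_gt0 v) absval_p invr_gt0. Qed.

Lemma dense_ratr x (r : R) : 0 < r -> exists q : rat, v (x - ratr q) < r.
Proof.
move=> r0; have [y [yx [q _ qy]]] := Qp_dense QpP
  (ex_intro _ x (vball_center (v := v) x r0 : [set y | v (y - x) < r] x))
  (@open_vball _ _ v x r).
by exists q; rewrite absvalB qy.
Qed.

(** A rational closer to x than |x| has the same absolute value, so [Qp] has no values beyond those
    of the rationals. *)
Lemma absval_group x : x != 0 -> exists k : int, v x = p%:R ^ k.
Proof.
move=> x0; have [q xq] := dense_ratr x (etrans (absval_gt0 v x) x0).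
have := absval_close xq; rewrite (Qp_abs_ratr QpP) /rat_padic_abs.
case: ifPn => q0; last by eexists; apply/esym; eassumption.
by move=> /esym/absval_eq0/eqP; rewrite (negbTE x0).
Qed.

Lemma absval_lt_expz x (k : int) : v x < p%:R ^ (k + 1) -> v x <= p%:R ^ k.
Proof.
have [->|x0] := eqVneq x 0; first by rewrite absval0 exprz_ge0// ltW.
have [j ->] := absval_group x0.
by rewrite ltr_eXz2l// ler_eXz2l// ltzD1.
Qed.

Lemma absval_lt1 x : v x < 1 -> v x <= p%:R^-1.
Proof. by move=> x1; rewrite -exprN1; apply: absval_lt_expz; rewrite subrr expr0z. Qed.

Lemma absval_int (z : int) : v z%:~R = v `|z|%N%:R.
Proof. by case: z => n //=; rewrite NegzE mulrNz absvalN. Qed.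

Lemma absval_int_le1 (z : int) : v z%:~R <= 1.
Proof. by rewrite absval_int absval_nat_le1. Qed.

(** By density x may be replaced by a rational. Being p-integral and reduced, it has a denominator
    prime to p, which can be inverted modulo p. *)
Lemma digit_ex x : v x <= 1 -> exists a : 'I_p, v (x - a%:R) < 1.
Proof.
move=> x1; have [q xq] := dense_ratr x ltr01.
suff [a qa] : exists a : 'I_p, v (ratr q - a%:R) < 1.
  by exists a; rewrite -(subrKA (ratr q)); apply: absvalD_lt.
have q1 : v (ratr q) <= 1.
  by rewrite -[ratr q](subKr x); apply: absvalB_le => //; exact: ltW.
have [->|q0] := eqVneq q 0.
  by exists (Ordinal (prime_gt0 p_prime)); rewrite -[0 : rat]/(0%:R) ratr_nat subrr absval0.
have pden : coprime p `|denq q|.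
  rewrite prime_coprime//; apply/negP => pd.
  move: q1; rewrite (Qp_abs_ratr QpP) /rat_padic_abs (negbTE q0).
  rewrite -[leRHS](expr0z p%:R) ler_eXz2l// subr_le0 lez_nat.
  apply/negP; rewrite -ltnNge.
  have := coprime_num_den q; rewrite /coprime => /eqP cnd.
  have : logn p `|numq q| = 0%N.
    apply: logn_coprime; rewrite prime_coprime//.
    apply/negP => pn; have : (p %| gcdn `|numq q| `|denq q|)%N by rewrite dvdn_gcd pn.
    by rewrite cnd dvdn1 gtn_eqF.
  by move=> ->; rewrite logn_gt0 mem_primes p_prime absz_gt0 denq_eq0.
have [u [w uw]] := Bezoutz p%:Z (denq q).
have {uw} uw : u * p%:Z + w * denq q = 1.
  by rewrite uw /gcdz absz_nat; move/eqP: pden => ->.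
have pZ : p%:Z != 0 by rewrite eqz_nat gtn_eqF// prime_gt0.
(* Bezout makes [w] an inverse of the denominator modulo p, so this residue is the digit sought. *)
pose n := ((w * numq q) %% p%:Z)%Z.
have n0 : 0 <= n by rewrite modz_ge0.
have np : (`|n| < p)%N by rewrite -ltz_nat gez0_abs// ltz_pmod// ltz_nat prime_gt0.
exists (Ordinal np) => /=.
have -> : `|n|%N%:R = n%:~R :> Qp by rewrite pmulrn gez0_abs.
have den1 : v (denq q)%:~R = 1.
  rewrite absval_int absval_nat ?absz_gt0 ?denq_eq0//.
  suff -> : logn p `|denq q| = 0%N by rewrite invr1.
  exact: logn_coprime.
have dn0 : (denq q)%:~R != 0 :> Qp by rewrite -(absval_gt0 v) den1.
have -> : ratr q - n%:~R = (numq q - n * denq q)%:~R / (denq q)%:~R :> Qp.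
  by rewrite /ratr intrB intrM mulrBl mulfK.
rewrite absvalM absvalV den1 invr1 mulr1.
have -> : numq q - n * denq q
    = p%:Z * (numq q * u + ((w * numq q) %/ p%:Z)%Z * denq q).
  have := divz_eq (w * numq q) p%:Z; rewrite -/n => e1.
  have -> : n = w * numq q - (w * numq q %/ p)%Z * p by apply/esym/eqP; rewrite subr_eq addrC -e1.
  by rewrite -[X in X - _](mulr1 (numq q)) -uw; ring.
rewrite rmorphM /= absvalM -pmulrn absval_p.
rewrite (le_lt_trans (y := p%:R^-1))//; last by rewrite invf_lt1.
by rewrite ler_piMr ?absval_int_le1// invr_ge0 ltW.
Qed.

Lemma geometric_small (C r : R) : 0 < r -> exists N, forall n, (N <= n)%N ->
  C * p%:R ^- n < r.
Proof.
move=> r0; have [C0|C0] := leP C 0.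
  by exists 0%N => n _; apply: le_lt_trans r0; rewrite mulr_le0_ge0// invr_ge0 exprn_ge0.
exists (Num.bound (C / r)) => n Nn.
rewrite ltr_pdivrMr ?exprn_gt0// mulrC -ltr_pdivrMr//.
apply: lt_le_trans (archi_boundP _) _; first by rewrite divr_ge0 ?ltW.
by rewrite -natrX ler_nat (leq_trans Nn)// ltnW// ltn_expl.
Qed.

Lemma geometric_le0 (C x : R) : (forall n, x <= C * p%:R ^- n) -> x <= 0.
Proof.
move=> xC; rewrite leNgt; apply/negP => x0.
have [N /(_ N (leqnn _))] := geometric_small C x0.
by rewrite ltNge xC.
Qed.

(** By the ultrametric inequality all steps after the n-th together move [s] no further than the
    bound on the n-th one, so the limit inherits that bound without a geometric-series factor. *)
Lemma Qp_geometric_limit (s : nat -> Qp) (C : R) :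
  (forall n, v (s n.+1 - s n) <= C * p%:R ^- n) ->
  exists b, forall n, v (b - s n) <= C * p%:R ^- n.
Proof.
move=> sC.
have C0 : 0 <= C by have := sC 0%N; rewrite expr0 invr1 mulr1; apply: le_trans (absval_ge0 _ _).
have Cn n : 0 <= C * p%:R ^- n by rewrite mulr_ge0// invr_ge0 exprn_ge0// ltW.
have sD n k : v (s (n + k)%N - s n) <= C * p%:R ^- n.
  elim: k => [|k IHk]; first by rewrite addn0 subrr absval0.
  rewrite -(subrKA (s (n + k)%N)); apply: absvalD_le => //.
  rewrite addnS; apply: le_trans (sC _) _; rewrite ler_wpM2l// lef_pV2 ?posrE ?exprn_gt0//.
  by rewrite ler_eXn2l// leq_addr.
pose t : nat -> valued v := s.
have : cvg (t @ \oo).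
  apply: (Qp_complete QpP); apply: cauchy_exP => r r0.
  have [N CN] := geometric_small C r0.
  exists (s N); exists N => // n /= Nn.
  rewrite /ball /= /vball absvalB -(subnKC Nn).
  exact: le_lt_trans (sD _ _) (CN _ _).
move=> /cvg_ballP; set b := lim _ => sb.
exists b => n; rewrite leNgt; apply/negP => bn.
have [M _ /(_ (n + M)%N)] := sb _ (le_lt_trans (Cn n) bn).
rewrite /= leq_addl => /(_ isT); rewrite /ball /= /vball => bM.
have : v (b - s (n + M)%N + (s (n + M)%N - s n)) < v (b - s n).
  by apply: absvalD_lt => //; apply: le_lt_trans bn.
by rewrite subrKA ltxx.
Qed.

Lemma padic_expansion_ex b : exists k a, padic_expansion (p := p) v b k a.
Proof.
have [k bk] : exists k : nat, v b <= p%:R ^+ k.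
  have [->|b0] := eqVneq b 0; first by exists 0%N; rewrite absval0 exprn_ge0// ltW.
  have [j ->] := absval_group b0.
  by exists `|j|%N; rewrite exprnP ler_eXz2l//; lia.
have /choice[d dP] x : exists a : 'I_p, v x <= 1 -> v (x - a%:R) < 1.
  have [/digit_ex[a xa]|_] := boolP (v x <= 1); first by exists a.
  by exists (Ordinal (prime_gt0 p_prime)).
have pk0 n : p%:R ^+ n != 0 :> Qp by rewrite expf_neq0// p_neq0.
(* [y n] is what remains of the integral element b p^k after n digits have been stripped; it stays
   integral because subtracting the digit makes it divisible by p. *)
pose y n := iter n (fun x => (x - (d x)%:R) / p%:R) (b * p%:R ^+ k).
have y1 n : v (y n) <= 1.
  elim: n => [|n IHn].
    by rewrite /y /= absvalM absvalX absval_p exprVn ler_pdivrMr ?exprn_gt0// mul1r.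
  rewrite /y iterS -/(y n) absvalM absvalV absval_p invrK.
  by rewrite -ler_pdivlMr// mul1r absval_lt1// dP.
have yE N : b * p%:R ^+ k = \sum_(0 <= i < N) (d (y i))%:R * p%:R ^+ i + p%:R ^+ N * y N.
  elim: N => [|N ->]; first by rewrite big_nil expr0 add0r mul1r.
  rewrite big_nat_recr//= -addrA; congr (_ + _).
  rewrite exprSr -mulrA [p%:R * _]mulrC divfK ?p_neq0//.
  by rewrite mulrBr [X in _ - X]mulrC addrC subrK.
exists k, (d \o y); apply/cvg_ballP => r r0.
have [N NP] := geometric_small (p%:R ^+ k) r0.
exists N => // n /= Nn; rewrite /ball /= /vball.
have -> : b - \sum_(0 <= i < n) (d (y i))%:R * p%:R ^ (i%:Z - k%:Z)
    = p%:R ^- k * (p%:R ^+ n * y n).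
  apply: (mulfI (pk0 k)); rewrite mulrA divff// mul1r mulrBr [X in X - _]mulrC (yE n).
  rewrite mulr_sumr.
  rewrite [X in X + _ - _](eq_bigr
    (fun i => p%:R ^+ k * ((d (y i))%:R * p%:R ^ (i%:Z - k%:Z)))).
    by rewrite addrAC subrr add0r.
  move=> i _; rewrite mulrCA; congr (_ * _).
  by rewrite [RHS]mulrC expfzDr ?p_neq0// -exprnN divfK.
apply: le_lt_trans (NP _ Nn); rewrite absvalM absvalV absvalX absval_p.
rewrite absvalM absvalX absval_p !exprVn invrK.
by rewrite ler_wpM2l ?exprn_ge0 ?(ltW pR0)// ler_piMr// invr_ge0 exprn_ge0 ?(ltW pR0).
Qed.

(** Indices above k carry positive exponents, so those terms have absolute value below 1; b is
    compared with a partial sum that reaches past k and lies within 1 of it. *)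
Lemma padic_expansion_floor b k a : padic_expansion (p := p) v b k a ->
  v (b - \sum_(0 <= i < k.+1) (a i)%:R * p%:R ^ (i%:Z - k%:Z)) < 1.
Proof.
move=> /cvg_ballP /(_ 1 ltr01)[N _ /(_ (k.+1 + N)%N)].
rewrite /= leq_addl => /(_ isT); rewrite /ball/= /vball.
rewrite (@big_cat_nat _ _ _ k.+1)//= ?leq_addr// opprD addrA => bN.
rewrite -[X in v X](subrK (\sum_(k.+1 <= i < k.+1 + N) (a i)%:R * p%:R ^ (i%:Z - k%:Z))).
apply: absvalD_lt => //; rewrite big_nat_cond; apply: absval_sum_lt => // i.
rewrite andbT => /andP[ki _]; rewrite absvalM absvalXz absval_p -exprN1 exprzAC.
apply: (le_lt_trans (y := p%:R ^ (k%:Z - i%:Z))).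
  by rewrite -exprzAC exprz_exp mulN1r opprB ler_piMl ?exprz_ge0 ?absval_nat_le1// ltW.
by rewrite -[ltRHS](expr0z p%:R) ltr_eXz2l//; lia.
Qed.

(** This form serves twice: the bound on n separates the elements of X, and the pair (k, n) shows
    that X is countable. *)
Lemma Xset_nat x : Xset p x ->
  exists k n, (n < p ^ k.+1)%N /\ x = n%:R * p%:R ^- k :> Qp.
Proof.
move=> [k [a ->]]; exists k.
elim: k => [|k [n [nk IHk]]].
  by exists (a 0%N); rewrite big_nat1 expn1.
exists (n * p + a k.+1)%N; split.
  by have := ltn_ord (a k.+1); rewrite [(p ^ k.+2)%N]expnSr; nia.
rewrite big_nat_recr//= IHk natrD mulrDl natrM; congr (_ + _).
by rewrite [p%:R ^+ k.+1]exprSr invfM mulrACA mulrA mulfK// p_neq0.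
Qed.

(** The powers of p being discrete, the bound p^(1-k) on the difference forces p^k to divide it,
    while the difference itself is smaller than p^k. *)
Lemma nat_close (k n n' : nat) : (n < p ^ k)%N -> (n' < p ^ k)%N ->
  v (n%:R - n'%:R) < p%:R ^- k * p%:R -> n = n'.
Proof.
wlog n'n : n n' / (n' <= n)%N => [th|] nk n'k nn'.
  by case/orP: (leq_total n n') => ?; [apply/esym|]; apply: th; rewrite // absvalB.
apply/eqP; move: n'n; rewrite leq_eqVlt eq_sym => /orP[//|n'n].
have D0 : (0 < n - n')%N by rewrite subn_gt0.
move: nn'; rewrite -natrB 1?ltnW// absval_nat// => lk.
have : (p ^ k %| n - n')%N.
  rewrite pfactor_dvdn// leqNgt; apply/negP => lk'.
  move: lk; apply/negP; rewrite -leNgt ler_pdivrMl ?exprn_gt0//.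
  by rewrite ler_pdivlMr ?exprn_gt0// -exprS ler_eXn2l.
by move=> /(dvdn_leq D0); rewrite leqNgt (leq_ltn_trans (leq_subr _ _)).
Qed.

Lemma Xset_inj x y : Xset p x -> Xset p y -> v (x - y) < 1 -> x = y.
Proof.
move=> /Xset_nat[k [n [nk ->]]] /Xset_nat[l [n' [n'l ->]]].
have pk0 i : p%:R ^+ i != 0 :> Qp by rewrite expf_neq0// p_neq0.
have -> : n%:R * p%:R ^- k - n'%:R * p%:R ^- l
    = ((n * p ^ l)%:R - (n' * p ^ k)%:R) * p%:R ^- (k + l) :> Qp.
  by rewrite !natrM !natrX exprD; field; rewrite !pk0.
rewrite absvalM absvalV absvalX absval_p exprVn invrK -ltr_pdivlMr ?exprn_gt0// => nn'.
suff e : (n * p ^ l)%N = (n' * p ^ k)%N.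
  apply: (mulIf (pk0 (k + l)%N)).
  transitivity ((n * p ^ l)%:R : Qp); last rewrite e.
    by rewrite natrM natrX exprD mulrA divfK.
  by rewrite natrM natrX [(k + l)%N]addnC exprD mulrA divfK.
(* Over the common denominator p^(k + l) both numerators have at most k + l + 1 digits, since X
   includes the digit of exponent 0. *)
apply: (@nat_close (k + l).+1).
- by rewrite -addSn expnD ltn_pmul2r ?expn_gt0 ?prime_gt0.
- by rewrite -addnS addnC expnD ltn_pmul2r ?expn_gt0 ?prime_gt0.
- by rewrite exprSr invfM -mulrA mulVf ?gt_eqF// mulr1 -div1r.
Qed.

Lemma padic_floorP b :
  Xset p (padic_floor p v b) /\ v (b - padic_floor p v b) < 1.
Proof.
rewrite /padic_floor; set P := (X in xget 0 X).
have : P (xget 0 P).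
  apply: xgetPex; have [k [a ba]] := padic_expansion_ex b.
  by eexists; exists k, a; split.
move: (xget 0 P) => y [k [a [ba ->]]]; split; last exact: padic_expansion_floor.
(* An expansion lists its digits by increasing exponent from -k, an element of X from exponent 0
   downwards; hence the reversal. *)
exists k, (fun i => a (k - i)%N).
rewrite big_nat_rev/= big_nat_cond [RHS]big_nat_cond; apply: eq_bigr => i /andP[/andP[_ ik] _].
rewrite add0n subSS exprnN; congr (_ * _ ^ _).
by move: ik; lia.
Qed.

End padic.

(** * Coordinates in the extension and the floor function *)

(** Uniqueness of the remainder modulo n. With n = e it tells apart the cosets of the powers of
    [beta]. *)
Lemma euclid_remainder_eq (n i j : nat) (k l : int) : (i < n)%N -> (j < n)%N ->
  i%:Z + n%:Z * l = j%:Z + n%:Z * k -> i = j.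
Proof.
move=> ilt jlt ijE.
have [kl|[kl|kl]] : k = l \/ (l + 1 <= k \/ k + 1 <= l) by lia.
- by move: ijE; rewrite kl; lia.
- nia.
- nia.
Qed.

Lemma subz_succ (k : int) (n : nat) : k - n.+1%:Z = k - n%:Z - 1.
Proof. lia. Qed.

Section extension_digits.
Context {R : realType} (p : nat) (p_prime : prime p).
Context {Qp : fieldType} (vQ : absvalue R Qp) (QpP : is_Qp p vQ).
Context {K : fieldExtType Qp} (vK : absvalue R K).
Context (vKQ : forall x : Qp, vK x%:A = vQ x).
Context (e f : nat) (eE : ramification_index vQ vK {:K}%AS e).
Context (fE : residue_degree vQ vK {:K}%AS f).
Context (gamma : K) (gamma_prim : (p ^ f - 1)%N.-primitive_root gamma).
Context (beta : K) (beta_abs : vK beta = p%:R `^ (e%:R^-1)).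

Local Notation b := (p%:R `^ (e%:R^-1) : R).

Let p1 : (1 < p)%N. Proof. exact: prime_gt1. Qed.
Let pR1 : 1 < p%:R :> R. Proof. by rewrite ltr1n. Qed.
Let pR0 : 0 < p%:R :> R. Proof. by rewrite ltr0n prime_gt0. Qed.

(** * Value group and residue classes of [K] *)

Lemma absvalZ c x : vK (c *: x) = vQ c * vK x.
Proof. by rewrite -mulr_algl absvalM vKQ. Qed.

Lemma absval_natK n : vK n%:R = vQ n%:R.
Proof. by rewrite -vKQ scaler_nat. Qed.

Lemma ramification_gt0 : (0 < e)%N.
Proof.
have [t [_ /(_ 1 (memvf 1) (oner_neq0 _)) [i _]]] := eE.
exact: leq_ltn_trans (ltn_ord i).
Qed.

Lemma residue_gt0 : (0 < f)%N.
Proof.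
rewrite lt0n; apply/eqP => f0; have [u [_ /(_ 1 (memvf _)) + _]] := fE.
rewrite absval1 lexx => /(_ isT)[a _].
suff -> : \sum_i a i *: u i = 0 by rewrite subr0 absval1 ltxx.
by apply: big1 => -[i ilt]; exfalso; move: ilt; rewrite f0.
Qed.

Lemma ramification_pow : b ^+ e = p%:R.
Proof.
rewrite -powR_mulrn ?powR_ge0// -powRrM mulVf ?powRr1 ?ler0n// pnatr_eq0.
by rewrite -lt0n ramification_gt0.
Qed.

Let b1 : 1 < b.
Proof.
rewrite ltNge; apply/negP => b1; move: pR1.
by rewrite -ramification_pow ltNge exprn_ile1 ?powR_ge0.
Qed.
Let b0 : 0 < b. Proof. exact: lt_trans b1. Qed.

(** The powers beta^0, ..., beta^(e-1) have absolute values p^(i/e), which lie in distinct cosets of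
    the value group of [Qp]. There are exactly e cosets, so by counting these powers represent all
    of them. *)
Lemma value_group (x : K) : x != 0 -> exists k : int, vK x = b ^ k.
Proof.
have bE k : p%:R ^ k = b ^ (e%:Z * k) by rewrite -{1}ramification_pow exprnP exprz_exp.
have beta0 : beta != 0 by rewrite -(absval_gt0 vK) beta_abs.
have [t [_ tP]] := eE.
have /choice[s sP] (j : 'I_e) : 
    exists i, exists2 a : Qp, a != 0 & vK (beta ^+ j) = vK (t i) * vQ a.
  by have [i []] := tP _ (memvf (beta ^+ j)) (expf_neq0 _ beta0); exists i.
have sI : injective s.
  move=> i j sij; have [a a0 iE] := sP i; have [c c0 jE] := sP j.
  have [k ak] := absval_group QpP a0; have [l cl] := absval_group QpP c0.
  move: iE jE; rewrite !absvalX beta_abs sij ak cl !bE => iE jE.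
  have : b ^ (i%:Z + e%:Z * l) = b ^ (j%:Z + e%:Z * k).
    by rewrite !expfzDr ?gt_eqF// -!exprnP iE jE mulrAC.
  move=> /(ieexprIz b0 (negbT (gt_eqF b1))) ijE;
  exact/val_inj/(euclid_remainder_eq (ltn_ord _) (ltn_ord _) ijE).
move=> x0; have [i [[a a0 xE] _]] := tP _ (memvf x) x0.
have [j sj] : exists j, s j = i by have := injF_bij sI; case=> g _ gK; exists (g i).
have [c c0] := sP j; rewrite sj absvalX beta_abs => jE.
have [k ak] := absval_group QpP a0; have [l cl] := absval_group QpP c0.
exists (j%:Z + e%:Z * (k - l)).
rewrite expfzDr ?gt_eqF// -bE expfzDr ?gt_eqF// -invr_expz -cl -ak -exprnP jE xE.
have : vQ c != 0 by rewrite gt_eqF// absval_gt0.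
by move=> ?; field.
Qed.

Lemma absval_lt1_uniformizer x : vK x < 1 -> vK x <= b^-1.
Proof.
have [->|x0] := eqVneq x 0; first by rewrite absval0 invr_ge0 ltW.
have [k ->] := value_group x0.
by rewrite -[ltRHS](expr0z b) -(exprN1 b) ltr_eXz2l// ler_eXz2l//; lia.
Qed.

Lemma absval_gamma : vK gamma = 1.
Proof.
have N0 := prim_order_gt0 gamma_prim.
apply/eqP; rewrite -(pexpr_eq1 N0) ?absval_ge0//.
by rewrite -absvalX (prim_expr_order gamma_prim) absval1.
Qed.

Lemma absval_order : vK (p ^ f - 1)%N%:R = 1.
Proof.
apply/eqP; rewrite eq_le absval_natK absval_nat_le1 leNgt; apply/negP => N1.
have : vQ ((p ^ f)%:R - (p ^ f - 1)%N%:R) < 1.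
  apply: absvalB_lt => //; rewrite natrX absvalX absval_p//.
  rewrite exprn_ilt1 ?invr_ge0 ?ler0n// ?invf_lt1//.
  by rewrite -lt0n residue_gt0.
by rewrite -natrB ?leq_subr// subKn ?expn_gt0 ?prime_gt0// absval1 ltxx.
Qed.

(** Let N = p^f - 1 and suppose a power x of [gamma] is congruent to 1 without being 1. As x^N = 1,
    the sum of the x^k over k < N vanishes; but it is congruent to N, which is a unit. *)
Lemma gamma_residues_distinct i j : (i < p ^ f - 1)%N -> (j < p ^ f - 1)%N ->
  vK (gamma ^+ i - gamma ^+ j) < 1 -> i = j.
Proof.
wlog ij : i j / (i <= j)%N => [th|] iN jN.
  by case/orP: (leq_total i j) => ? ?; [|apply/esym]; apply: th; rewrite // absvalB.
rewrite -(subnKC ij) exprD -[X in X - _]mulr1 -mulrBr absvalM absvalX absval_gamma.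
rewrite expr1n mul1r absvalB; set x := gamma ^+ (j - i) => x1.
have [x1E|x1E] := eqVneq x 1.
  have xE : x == 1 by apply/eqP.
  move: xE; rewrite /x -(prim_order_dvd gamma_prim) => dN.
  suff : (j - i == 0)%N by move=> /eqP ->; rewrite addn0.
  move: dN; apply: contraTT; rewrite -lt0n => ji0.
  by rewrite gtnNdvd// (leq_ltn_trans (leq_subr _ _)).
have xN : x ^+ (p ^ f - 1) = 1.
  by rewrite /x exprAC (prim_expr_order gamma_prim) expr1n.
have xk1 k : vK (x ^+ k) = 1 by rewrite !absvalX absval_gamma !expr1n.
have /eqP : (x - 1) * (\sum_(k < p ^ f - 1) x ^+ k) = 0 by rewrite -subrX1 xN subrr.
rewrite mulf_eq0 subr_eq0 (negbTE x1E) /= => /eqP s0.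
suff : vK (p ^ f - 1)%N%:R < 1 by rewrite absval_order ltxx.
have -> : (p ^ f - 1)%N%:R = \sum_(k < p ^ f - 1) (1 - x ^+ k).
  by rewrite sumrB s0 subr0 sumr_const card_ord.
apply: absval_sum_lt => // k _; rewrite absvalB subrX1 absvalM.
apply: le_lt_trans x1; rewrite ler_piMr ?absval_ge0//.
by apply: absval_sum_le => // l _; rewrite xk1.
Qed.

(** These p^f elements represent each residue class of [K] exactly once, as [digit_sum_inj] and
    [digit_sum_ex] show. *)
Definition digit_sum (a : {ffun 'I_f -> 'I_p}) : K :=
  \sum_(j < f) (a j)%:R *: gamma ^+ j.

Lemma absval_gamma_sum_le d (c : nat -> Qp) (r : R) : 0 <= r ->
  (forall j, (j < d)%N -> vQ (c j) <= r) ->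
  vK (\sum_(j < d) c j *: gamma ^+ j) <= r.
Proof.
move=> r0 cr; apply: absval_sum_le => // j _.
by rewrite absvalZ absvalX absval_gamma expr1n mulr1 cr.
Qed.

(* If gamma ^ d were congruent to an integral combination of lower powers, so
   would be all its powers, and p ^ f residues would be represented by p ^ d
   digit strings. *)
Lemma gamma_powers_independent d (c : nat -> Qp) : (d < f)%N ->
  (forall j, (j < d)%N -> vQ (c j) <= 1) ->
  ~ vK (gamma ^+ d - \sum_(j < d) c j *: gamma ^+ j) < 1.
Proof.
move=> df c1 cd.
pose S (x : K) := exists2 a : nat -> Qp, (forall j, vQ (a j) <= 1) &
  vK (x - \sum_(j < d) a j *: gamma ^+ j) < 1.
have SD x y : S x -> S y -> S (x + y).
  move=> [a a1 xa] [a' a'1 ya']; exists (fun j => a j + a' j).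
    by move=> j; apply: absvalD_le.
  under eq_bigr do rewrite scalerDl.
  by rewrite big_split/= opprD addrACA; apply: absvalD_lt.
have SZ q x : vQ q <= 1 -> S x -> S (q *: x).
  move=> q1 [a a1 xa]; exists (fun j => q * a j).
    by move=> j; rewrite absvalM mulr_ile1 ?absval_ge0.
  under eq_bigr do rewrite -scalerA.
  rewrite -scaler_sumr -scalerBr absvalZ.
  by apply: le_lt_trans xa; rewrite ler_piMl ?absval_ge0.
have Scongr x y : vK (x - y) < 1 -> S y -> S x.
  move=> xy [a a1 ya]; exists a => //.
  by rewrite -(subrKA y); apply: absvalD_lt.
have S0 : S 0.
  exists (fun=> 0) => [j|]; first by rewrite absval0.
  by rewrite big1 ?subrr ?absval0// => j _; rewrite scale0r.
have Ssum n (F : 'I_n -> K) : (forall i, S (F i)) -> S (\sum_i F i).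
  by move=> SF; apply: (big_ind S).
have Slt j : (j < d)%N -> S (gamma ^+ j).
  move=> jd; exists (fun i => (i == j)%:R) => [i|]; first exact: absval_nat_le1.
  rewrite (bigD1 (Ordinal jd))//= eqxx scale1r big1 ?addr0 ?subrr ?absval0//.
  by move=> i /negPf; rewrite -val_eqE/= => ->; rewrite scale0r.
have Sd : S (gamma ^+ d).
  by apply: (Scongr _ _ cd); apply: Ssum => j; apply: SZ; [exact: c1|exact: Slt].
have Sg x : S x -> S (gamma * x).
  move=> [a a1 xa]; apply: (Scongr _ (\sum_(j < d) a j *: gamma ^+ j.+1)).
    under eq_bigr do rewrite exprS scalerAr.
    by rewrite -mulr_sumr -mulrBr absvalM absval_gamma mul1r.
  apply: Ssum => j; apply: SZ => //.
  by have := ltn_ord j; rewrite leq_eqVlt => /orP[/eqP ->//|/Slt].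
have Spow n : S (gamma ^+ n).
  have S1 : S 1.
    by have [d0|d0] := posnP d; [move: Sd; rewrite d0|have := Slt _ d0]; rewrite expr0.
  by elim: n => [|n IHn]; rewrite ?expr0// exprS; apply: Sg.
have Sdigit x : S x -> exists a : {ffun 'I_d -> 'I_p},
    vK (x - \sum_(j < d) (a j)%:R *: gamma ^+ j) < 1.
  move=> [a a1 xa].
  have /choice[g gP] (j : 'I_d) := digit_ex p_prime QpP (a1 j).
  exists (finfun g); rewrite -(subrKA (\sum_(j < d) a j *: gamma ^+ j)).
  apply: absvalD_lt => //; rewrite -sumrB; apply: absval_sum_lt => // j _.
  by rewrite -scalerBl absvalZ absvalX absval_gamma expr1n mulr1 ffunE.
(* The last index stands for the class of 0, which joins the p^f - 1 powers of [gamma] to make p^f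
   distinct classes. *)
have /choice[h hP] (i : 'I_(p ^ f)) : exists a : {ffun 'I_d -> 'I_p},
    vK ((if (i < p ^ f - 1)%N then gamma ^+ i else 0)
      - \sum_(j < d) (a j)%:R *: gamma ^+ j) < 1.
  by apply: Sdigit; case: ifP.
have hI : injective h.
  move=> i j hij; apply: val_inj => /=.
  have := absvalB_lt (hP i) (hP j); rewrite hij opprB subrKA.
  case: ifPn => iN; case: ifPn => jN.
  - exact: gamma_residues_distinct.
  - by rewrite subr0 absvalX absval_gamma expr1n ltxx.
  - by rewrite sub0r absvalN absvalX absval_gamma expr1n ltxx.
  - by move=> _; have := ltn_ord i; have := ltn_ord j; move: iN jN; lia.
have := leq_card h hI; rewrite card_ffun !card_ord leqNgt.
by rewrite ltn_exp2l// df.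
Qed.

(** Let d be the last index with a unit coefficient. The later terms are negligible, so dividing by
    c d expresses gamma^d through lower powers, against [gamma_powers_independent]. *)
Lemma absval_gamma_sum_lt1 (c : nat -> Qp) :
  (forall j, (j < f)%N -> vQ (c j) <= 1) ->
  vK (\sum_(j < f) c j *: gamma ^+ j) < 1 ->
  forall j, (j < f)%N -> vQ (c j) < 1.
Proof.
move=> c1 cs j0 j0f; rewrite ltNge; apply/negP => cj0.
have [d /= dP dmax] := @arg_maxnP _ (Ordinal j0f) (fun j : 'I_f => 1 <= vQ (c j)) (@nat_of_ord f) cj0.
have cd1 : vQ (c d) = 1 by apply/eqP; rewrite eq_le dP c1.
have cd0 : c d != 0 by rewrite -(absval_gt0 vQ) cd1.
have high : vK (\sum_(j < f | ~~ (j < d.+1)%N) c j *: gamma ^+ j) < 1.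
  apply: absval_sum_lt => // j; rewrite ltnS => dj.
  rewrite absvalZ absvalX absval_gamma expr1n mulr1 ltNge; apply/negP => /dmax.
  by rewrite leqNgt ltnNge dj.
have low : vK (\sum_(j < d.+1) c j *: gamma ^+ j) < 1.
  rewrite (big_ord_widen _ (fun j => c j *: gamma ^+ j) (ltn_ord d)).
  move: cs; rewrite (bigID (fun j : 'I_f => (j < d.+1)%N))/= => cs.
  rewrite -[X in vK X](addrK (\sum_(j < f | ~~ (j < d.+1)%N) c j *: gamma ^+ j)).
  exact: absvalB_lt.
apply: (@gamma_powers_independent d (fun j => - (c d)^-1 * c j) (ltn_ord d)).
  move=> j jd; rewrite absvalM absvalN absvalV cd1 invr1 mul1r c1//.
  exact: ltn_trans (ltn_ord d).
have -> : gamma ^+ d - \sum_(j < d) (- (c d)^-1 * c j) *: gamma ^+ j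
    = (c d)^-1 *: \sum_(j < d.+1) c j *: gamma ^+ j.
  rewrite big_ord_recr/= scalerDr scalerA mulVf// scale1r addrC; congr (_ + _).
  rewrite scaler_sumr -sumrN; apply: eq_bigr => j _.
  by rewrite mulNr scaleNr opprK scalerA.
by rewrite absvalZ absvalV cd1 invr1 mul1r.
Qed.

Lemma absval_gamma_sum_ge (c : nat -> Qp) j : (j < f)%N ->
  vQ (c j) <= vK (\sum_(j < f) c j *: gamma ^+ j).
Proof.
move=> jf.
have [d _ dmax] := @arg_maxP _ _ _ (Ordinal jf) xpredT (fun k : 'I_f => vQ (c k)) isT.
have {}dmax k : (k < f)%N -> vQ (c k) <= vQ (c d) by move=> kf; apply: (dmax (Ordinal kf)).
have [cd0|cd0] := eqVneq (c d) 0.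
  by apply: le_trans (dmax _ jf) _; rewrite cd0 absval0 absval_ge0.
apply: le_trans (dmax _ jf) _; rewrite leNgt; apply/negP => cs.
have vcd0 : 0 < vQ (c d) by rewrite absval_gt0.
suff : vQ ((c d)^-1 * c d) < 1 by rewrite mulVf// absval1 ltxx.
apply: (@absval_gamma_sum_lt1 (fun j => (c d)^-1 * c j)) => // [k kf|].
  by rewrite absvalM absvalV ler_pdivrMl// mulr1 dmax.
under eq_bigr do rewrite -scalerA.
by rewrite -scaler_sumr absvalZ absvalV ltr_pdivrMl// mulr1.
Qed.

Lemma digit_sum_inj a a' : vK (digit_sum a - digit_sum a') < 1 -> a = a'.
Proof.
move=> aa'; apply/ffunP => j; apply: val_inj => /=.
pose c (i : nat) : Qp := if insub i is Some k then (a k)%:R - (a' k)%:R else 0.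
have cE (k : 'I_f) : c k = (a k)%:R - (a' k)%:R by rewrite /c valK.
apply: (nat_close p_prime QpP (k := 1)); rewrite ?expn1// expr1 mulVf ?gt_eqF// -cE.
apply: absval_gamma_sum_lt1 => // [k kf|].
  by rewrite (cE (Ordinal kf)); apply: absvalB_le; apply: absval_nat_le1.
rewrite (eq_bigr (fun k : 'I_f => (a k)%:R *: gamma ^+ k - (a' k)%:R *: gamma ^+ k)).
  by rewrite sumrB.
by move=> k _; rewrite cE scalerBl.
Qed.

Lemma digit_sum_le1 a : vK (digit_sum a) <= 1.
Proof.
apply: absval_sum_le => // j _.
by rewrite absvalZ absvalX absval_gamma expr1n mulr1 absval_nat_le1.
Qed.

(** A counting argument: the p^f digit combinations of a residue basis u meet every class, and
    sending each digit sum to the combination in its class is injective, hence onto. *)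
Lemma digit_sum_ex x : vK x <= 1 -> exists a, vK (x - digit_sum a) < 1.
Proof.
have [u [u1 uP _]] := fE.
pose U (a : {ffun 'I_f -> 'I_p}) := \sum_(j < f) (a j)%:R *: u j.
have Uex y : vK y <= 1 -> exists a, vK (y - U a) < 1.
  move=> /(uP _ (memvf y))[q q1].
  have /choice[g gP] (j : 'I_f) := digit_ex p_prime QpP (q1 j).
  move=> /[dup] yq; exists (finfun g); rewrite -(subrKA (\sum_i q i *: u i)).
  apply: absvalD_lt => //; rewrite -sumrB; apply: absval_sum_lt => // j _.
  rewrite -scalerBl absvalZ ffunE; apply: le_lt_trans (gP j).
  by rewrite ler_piMr ?absval_ge0//; case: (u1 j).
have /choice[g gP] a := Uex _ (digit_sum_le1 a).
have gI : injective g.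
  move=> a a' gaa'; apply: digit_sum_inj.
  by have := absvalB_lt (gP a) (gP a'); rewrite gaa' opprB subrKA.
move=> /Uex[a xa]; have [g' _ g'K] := injF_bij gI; exists (g' a).
have := absvalB_lt xa (gP (g' a)).
by rewrite g'K opprB subrKA.
Qed.

(** * Size and existence of the coordinates *)

Local Notation lc := (@lincomb Qp K e f gamma beta).

Lemma lincombE B : lc B = \sum_(i < e) (\sum_(j < f) B i j *: gamma ^+ j) * beta ^+ i.
Proof.
apply: eq_bigr => i _; rewrite mulr_suml; apply: eq_bigr => j _.
by rewrite scalerAl.
Qed.

Lemma lincombB B B' : lc (B - B') = lc B - lc B'.
Proof.
rewrite /lincomb -sumrB; apply: eq_bigr => i _; rewrite -sumrB.
by apply: eq_bigr => j _; rewrite !mxE scalerBl.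
Qed.

Lemma lincomb_lt (B : 'M[Qp]_(e, f)) (r : R) : 0 < r ->
  (forall i j, vQ (B i j) * b ^+ i < r) -> vK (lc B) < r.
Proof.
move=> r0 Br; apply: absval_sum_lt => // i _; apply: absval_sum_lt => // j _.
by rewrite absvalZ absvalM !absvalX absval_gamma expr1n mul1r beta_abs.
Qed.

Lemma lincomb_le (B : 'M[Qp]_(e, f)) (r : R) : 0 <= r ->
  (forall i j, vQ (B i j) * b ^+ i <= r) -> vK (lc B) <= r.
Proof.
move=> r0 Br; apply: absval_sum_le => // i _; apply: absval_sum_le => // j _.
by rewrite absvalZ absvalM !absvalX absval_gamma expr1n mul1r beta_abs.
Qed.

Lemma absval_gamma_sum_eq (c : 'I_f -> Qp) :
  exists2 d, vK (\sum_(j < f) c j *: gamma ^+ j) = vQ (c d)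
    & forall j, vQ (c j) <= vQ (c d).
Proof.
pose c' (i : nat) : Qp := if insub i is Some k then c k else 0.
have cE (k : 'I_f) : c k = c' k by rewrite /c' valK.
have [d _ dmax] := @arg_maxP _ _ _ (Ordinal residue_gt0) xpredT (fun k => vQ (c k)) isT.
exists d; last by move=> j; apply: dmax.
under eq_bigr do rewrite cE.
apply/eqP; rewrite eq_le cE absval_gamma_sum_ge// andbT.
apply: absval_gamma_sum_le => [|j jf]; first exact: absval_ge0.
by have := dmax (Ordinal jf) isT; rewrite !cE.
Qed.

(** Row i has absolute value p^(i/e) times a value of [Qp], so nonzero rows have distinct absolute
    values, their exponents differing modulo e; [absval_sum_distinct] then applies. *)
Lemma lincomb_ge (B : 'M[Qp]_(e, f)) i j : vQ (B i j) * b ^+ i <= vK (lc B).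
Proof.
rewrite lincombE.
have vE k : vK ((\sum_(j < f) B k j *: gamma ^+ j) * beta ^+ k)
    = vK (\sum_(j < f) B k j *: gamma ^+ j) * b ^+ k.
  by rewrite absvalM absvalX beta_abs.
apply: le_trans (absval_sum_distinct _ i); last first.
  move=> k l; rewrite !vE mulf_eq0 negb_or => /andP[+ _].
  have [d dE _] := absval_gamma_sum_eq (B k).
  have [d' d'E _] := absval_gamma_sum_eq (B l).
  rewrite -(absval_gt0 vK) dE d'E absval_gt0 => /[dup] kd0 /(absval_group QpP)[x xE].
  move=> kl; have ld0 : B l d' != 0.
    rewrite -(absval_gt0 vQ) -(pmulr_lgt0 _ (exprn_gt0 l b0)) -kl.
    by rewrite pmulr_lgt0 ?exprn_gt0// absval_gt0.
  have [y yE] := absval_group QpP ld0; move: kl; rewrite xE yE.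
  have bE z : p%:R ^ z = b ^ (e%:Z * z) by rewrite -{1}ramification_pow exprnP exprz_exp.
  rewrite !bE !exprnP -!expfzDr ?gt_eqF// => /(ieexprIz b0 (negbT (gt_eqF b1))).
  rewrite addrC [RHS]addrC => kl.
  exact/val_inj/(euclid_remainder_eq (ltn_ord _) (ltn_ord _) kl).
rewrite vE ler_pM2r ?exprn_gt0//.
by have [d -> ->] := absval_gamma_sum_eq (B i).
Qed.

(** Writing k = t e + i, the element p^(-t) beta^i has absolute value exactly b^k. Dividing x by it
    gives an integral element, whose residue is a digit sum. *)
Lemma lincomb_step (k : int) x : vK x <= b ^ k ->
  exists2 B : 'M[Qp]_(e, f), vK (x - lc B) <= b ^ (k - 1)
    & forall i j, vQ (B i j) * b ^+ i <= b ^ k.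
Proof.
have e0 := ramification_gt0; have bn0 : b != 0 by rewrite gt_eqF.
have bz0 z : 0 < b ^ z by rewrite exprz_gt0.
have beta0 : beta != 0 by rewrite -(absval_gt0 vK) beta_abs.
pose t := (k %/ e%:Z)%Z; pose i := `|(k %% e%:Z)%Z|%N.
have iE : (k %% e%:Z)%Z = i by rewrite gez0_abs// modz_ge0// eqz_nat -lt0n.
have ie : (i < e)%N by rewrite -ltz_nat -iE ltz_pmod// ltz_nat.
have kE : k = t * e%:Z + i by rewrite -iE /t -divz_eq.
pose c : Qp := p%:R ^ (- t).
have p0 : p%:R != 0 :> Qp := p_neq0 p_prime QpP.
have c0 : c != 0 by rewrite expfz_neq0.
have vc : vQ c * b ^+ i = b ^ k.
  rewrite absvalXz absval_p// -(exprN1 p%:R) exprz_exp mulN1r opprK kE expfzDr//.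
  by rewrite -{1}ramification_pow exprnP exprz_exp [t * _]mulrC.
have vs : vK (c *: beta ^+ i) = b ^ k by rewrite absvalZ absvalX beta_abs.
have s0 : c *: beta ^+ i != 0 by rewrite -(absval_gt0 vK) vs.
move=> xk; have [|a xa] := @digit_sum_ex (x / (c *: beta ^+ i)).
  by rewrite absvalM absvalV vs ler_pdivrMr// mul1r.
pose B : 'M[Qp]_(e, f) := \matrix_(i', j) if i' == i :> nat then (a j)%:R * c else 0.
have BE : lc B = digit_sum a * (c *: beta ^+ i).
  rewrite lincombE (bigD1 (Ordinal ie))//= [X in _ + X]big1 ?addr0.
    rewrite -scalerAr scalerAl scaler_sumr; congr (_ * _); apply: eq_bigr => j _.
    by rewrite mxE /= eqxx scalerA mulrC.
  move=> l; rewrite -val_eqE/= => /negPf li.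
  by rewrite big1 ?mul0r// => j _; rewrite mxE li scale0r.
exists B => [|i' j].
  have : vK ((x / (c *: beta ^+ i) - digit_sum a) * (c *: beta ^+ i)) < b ^ k.
    by rewrite absvalM vs -ltr_pdivlMr// divff ?gt_eqF.
  rewrite mulrBl divfK// -BE.
  have [->|y0] := eqVneq (x - lc B) 0; first by rewrite absval0 ltW.
  have [l ->] := value_group y0.
  by rewrite ltr_eXz2l// ler_eXz2l// -ltzD1 subrK.
rewrite mxE; case: eqVneq => [->|_]; last by rewrite absval0 mul0r ltW.
by rewrite -vc absvalM -mulrA ler_piMl ?absval_nat_le1// mulr_ge0 ?absval_ge0// exprn_ge0// ltW.
Qed.

Lemma lincomb_steps (k : int) x (n : nat) : vK x <= b ^ k ->
  exists2 B : 'M[Qp]_(e, f), vK (x - lc B) <= b ^ (k - n%:Z)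
    & forall i j, vQ (B i j) * b ^+ i <= b ^ k.
Proof.
move=> xk; elim: n => [|n [B xB Bk]].
  exists 0 => [|i j]; last by rewrite mxE absval0 mul0r exprz_ge0// ltW.
  by rewrite subr0 /lincomb big1 ?subr0// => i _; rewrite big1// => j _; rewrite mxE scale0r.
have [C xC Ck] := lincomb_step xB; exists (B - - C) => [|i j].
  rewrite lincombB -[- C]sub0r lincombB {2}/lincomb.
  rewrite [\sum_(i < e) _]big1 => [|i _]; last by rewrite big1// => j _; rewrite mxE scale0r.
  rewrite sub0r opprK opprD addrA; apply: le_trans xC _.
  by rewrite subz_succ.
rewrite mxE opprK -ler_pdivlMr ?exprn_gt0//; apply: absvalD_le.
  by rewrite ler_pdivlMr ?exprn_gt0.
rewrite ler_pdivlMr ?exprn_gt0//; apply: le_trans (Ck i j) _.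
by rewrite ler_eXz2l// lerBlDr lerDl.
Qed.

(** Successive approximation: e steps reduce the error by b^e = p while the coordinates of the
    correction are no larger than the previous error, so the coordinates converge in [Qp]. *)
Lemma lincomb_surj x : exists B, lc B = x.
Proof.
have e0 := ramification_gt0.
have pE z : p%:R ^ z = b ^ (e%:Z * z) by rewrite -{1}ramification_pow exprnP exprz_exp.
have pz0 z : 0 < p%:R ^ z :> R by rewrite exprz_gt0.
have b1i (i : 'I_e) : 1 <= b ^+ i by rewrite exprn_ege1// ltW.
have bip (i : 'I_e) : b ^+ i <= p%:R.
  by rewrite -{2}ramification_pow ler_eXn2l// ltnW.
have /choice[g gP] (yk : K * int) : exists B : 'M[Qp]_(e, f), vK yk.1 <= p%:R ^ yk.2 ->
    vK (yk.1 - lc B) <= p%:R ^ (yk.2 - 1) /\ forall i j, vQ (B i j) <= p%:R ^ yk.2.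
  have [yk1|_] := boolP (vK yk.1 <= p%:R ^ yk.2); last by exists 0.
  move: (yk1); rewrite pE => /(lincomb_steps e)[B xB BB]; exists B => _; split.
    by rewrite pE mulrBr mulr1.
  move=> i j; apply: le_trans (BB i j).
  by rewrite ler_peMr ?absval_ge0.
have [k xk] : exists k : int, vK x <= p%:R ^ k.
  have [->|x0] := eqVneq x 0; first by exists 0; rewrite absval0 ltW.
  have [k ->] := value_group x0; exists `|k|.
  by rewrite pE ler_eXz2l//; apply: le_trans (ler_norm _) _; rewrite ler_peMl// lez_nat.
pose S := fix S n := if n is n'.+1 then S n' + g (x - lc (S n'), k - n'%:Z) else 0.
have lc0 : lc 0 = 0 by rewrite -[in LHS](subrr 0) lincombB subrr.
have lcD B B' : lc (B + B') = lc B + lc B'.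
  by rewrite -[B' in LHS]opprK -[- B' in LHS]sub0r !lincombB lc0 sub0r opprK.
have xS n : vK (x - lc (S n)) <= p%:R ^ (k - n%:Z).
  elim: n => [|n IHn]; first by rewrite /= lc0 !subr0.
  have [/= {}IHn _] := gP (x - lc (S n), k - n%:Z) IHn.
  by rewrite /= lcD opprD addrA subz_succ.
have kn n : p%:R ^ (k - n%:Z) = p%:R ^ k * p%:R ^- n :> R.
  by rewrite expfzDr ?gt_eqF// -exprnN.
have /choice[B BP] (i : 'I_e) : exists B, forall j n, vQ (B j - S n i j) <= p%:R ^ k * p%:R ^- n.
  have /choice[B BP] (j : 'I_f) : exists B, forall n, vQ (B - S n i j) <= p%:R ^ k * p%:R ^- n.
    apply: (Qp_geometric_limit p_prime QpP) => n.
    by rewrite /= mxE [X in X - _]addrC addrK -kn; case: (gP (_, _) (xS n)).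
  by exists B.
exists (\matrix_(i, j) B i j); set C := \matrix_(i, j) _.
apply/eqP; rewrite -subr_eq0; apply/eqP/(absval_eq0 vK)/eqP.
rewrite eq_le absval_ge0 andbT.
(* The extra factor p absorbs |beta|^i <= p for i < e when errors of coordinates become an error in
   [K]. *)
apply: (geometric_le0 p_prime (C := p%:R ^ k * p%:R)) => n.
rewrite -(subrKA (lc (S n))); apply: absvalD_le.
  rewrite -lincombB; apply: lincomb_le => [|i j].
    by rewrite mulr_ge0 ?invr_ge0 ?exprn_ge0// mulr_ge0// ltW.
  rewrite !mxE mulrAC; apply: ler_pM (BP _ _ _) _ => //; exact: absval_ge0.
rewrite absvalB; apply: le_trans (xS n) _; rewrite kn mulrAC ler_peMr ?(ltW pR1)//.
by rewrite -kn ltW.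
Qed.

Lemma dim_extension : \dim {:K} = (e * f)%N.
Proof.
have lin : linear lc.
  move=> c B B'; rewrite /lincomb scaler_sumr -big_split; apply: eq_bigr => i _.
  rewrite scaler_sumr -big_split; apply: eq_bigr => j _.
  by rewrite !mxE /= scalerDl scalerA.
pose L := GRing.isLinear.Build Qp 'M[Qp]_(e, f) K *:%R lc lin.
pose lcL : {linear 'M[Qp]_(e, f) -> K} := HB.pack lc L.
have := limg_ker_dim (linfun lcL) fullv.
have -> : lker (linfun lcL) = 0%VS.
  apply/eqP; rewrite -subv0; apply/subvP => B; rewrite memv_ker lfunE /= memv0 => /eqP B0.
  apply/eqP/matrixP => i j; rewrite mxE; apply/(absval_eq0 vQ)/eqP.
  rewrite eq_le absval_ge0 andbT -(pmulr_lle0 _ (exprn_gt0 i b0)).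
  by apply: le_trans (lincomb_ge _ _ _) _; rewrite B0 absval0.
rewrite capv0 dimv0 add0n dimvf dim_matrix => efE.
transitivity (\dim (linfun lcL @: fullv)); last exact: efE.
congr (\dim _).
apply/esym/eqP; rewrite eqEsubv subvf; apply/subvP => x _; have [B <-] := lincomb_surj x.
by apply/memv_imgP; exists B; rewrite ?memvf// lfunE.
Qed.

Local Notation fl := (Defs.floorK p vQ e f gamma beta).

Lemma coordinatesK x : lc (coordinates e f gamma beta x) = x.
Proof. by rewrite /coordinates; have := xgetPex 0 (lincomb_surj x). Qed.

(** The weight |beta|^i may exceed 1, but it stays below p for i < e, and a fractional coordinate of
    absolute value below 1 is at most 1/p. *)
Lemma floorKP x : Zset p e f gamma beta (fl x) /\ vK (x - fl x) < 1.
Proof.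
have flP i j := padic_floorP p_prime QpP (coordinates e f gamma beta x i j).
split; first by eexists; [|reflexivity] => i j; rewrite mxE; case: (flP i j).
rewrite -{1}(coordinatesK x) -lincombB; apply: lincomb_lt => // i j.
rewrite !mxE; case: (flP i j) => _ /(absval_lt1 p_prime QpP) xp; apply: (@le_lt_trans _ _ (p%:R^-1 * b ^+ i)).
  by rewrite ler_wpM2r// exprn_ge0// ltW.
by rewrite ltr_pdivrMl// mulr1 -{2}ramification_pow ltr_eXn2l.
Qed.

Lemma Zset_inj z z' : Zset p e f gamma beta z -> Zset p e f gamma beta z' ->
  vK (z - z') < 1 -> z = z'.
Proof.
move=> [B BX ->] [B' B'X ->]; rewrite -lincombB => BB'; congr lincomb.
apply/matrixP => i j; apply: (Xset_inj p_prime QpP) => //.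
have := le_lt_trans (lincomb_ge (B - B') i j) BB'; rewrite !mxE.
by apply: le_lt_trans; rewrite ler_peMr ?absval_ge0// exprn_ege1// ltW.
Qed.

Lemma floorKD z y : Zset p e f gamma beta z -> vK y < 1 -> fl (z + y) = z.
Proof.
move=> zZ y1; have [flZ fl1] := floorKP (z + y).
apply: Zset_inj => //; rewrite -(subrKA (z + y)).
by apply: absvalD_lt; [rewrite absvalB|rewrite [z + y]addrC addrK].
Qed.

End extension_digits.

(** * Measure of disks *)

Section ball_measure.
Context {R : realType} {F : fieldType} (v : absvalue R F).

Definition vdisk (c : F) (r : R) : set (borel v) := [set x | v (x - c) < r].

Lemma vdisk0 r : vdisk 0 r = [set x | v x < r].
Proof. by apply/seteqP; split => x; rewrite /vdisk /= subr0. Qed.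

Lemma measurable_vdisk c r : measurable (vdisk c r).
Proof. apply: sub_sigma_algebra; exact: open_vball. Qed.

Context (q : nat) (u : F) (rep : 'I_q -> F).
Hypothesis u_gt0 : 0 < v u.
Hypothesis u_lt1 : v u < 1.
Hypothesis u_max : forall x, v x < 1 -> v x <= v u.
Hypothesis rep_le1 : forall i, v (rep i) <= 1.
Hypothesis rep_inj : forall i j, v (rep i - rep j) < 1 -> i = j.
Hypothesis rep_surj : forall x, v x <= 1 -> exists i, v (x - rep i) < 1.
Context (mu : {measure set (borel v) -> \bar R}) (mu_haar : is_haar mu).
Hypothesis mu_unit : mu (vdisk 0 1) = 1%E.

Lemma measure_vdisk_center c r : mu (vdisk c r) = mu (vdisk 0 r).
Proof.
rewrite -(haar_translation mu_haar c (measurable_vdisk 0 r)); congr (mu _).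
apply/seteqP; split => x; rewrite /vdisk /=.
  by move=> xc; exists (x - c); rewrite ?subr0// addrC subrK.
by move=> [y]; rewrite subr0 => yr <-; rewrite addrC addKr.
Qed.

(** By [u_max], |x| < |u|^k means |x| <= |u|^(k+1). Dividing by u^(k+1) thus lands in the closed
    unit disk, which [rep] splits into q translates of the open one. *)
Lemma measure_vdisk_step k :
  mu (vdisk 0 (v u ^+ k)) = (q%:R%:E * mu (vdisk 0 (v u ^+ k.+1)))%E.
Proof.
have u0 : u != 0 by rewrite -(absval_gt0 v).
have uk0 n : 0 < v u ^+ n by rewrite exprn_gt0.
have vuk n : v (u ^+ n) = v u ^+ n by rewrite absvalX.
pose D (i : 'I_q) := vdisk (u ^+ k.+1 * rep i) (v u ^+ k.+1).
have -> : vdisk 0 (v u ^+ k) = \big[setU/set0]_(i < q) D i.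
  apply/seteqP; split => [x|].
    rewrite /vdisk /= subr0 => xk.
    have : v (x / u ^+ k) < 1 by rewrite absvalM absvalV vuk ltr_pdivrMr// mul1r.
    move=> /u_max; rewrite absvalM absvalV vuk ler_pdivrMr// -exprS => xk1.
    have [|i xi] := @rep_surj (x / u ^+ k.+1).
      by rewrite absvalM absvalV vuk ler_pdivrMr// mul1r.
    rewrite (bigD1 i)//=; left; rewrite /D /vdisk /=.
    have -> : x - u ^+ k.+1 * rep i = u ^+ k.+1 * (x / u ^+ k.+1 - rep i).
      by rewrite mulrBr mulrCA divff ?mulr1// expf_neq0.
    by rewrite absvalM vuk gtr_pMr.
  apply: (big_ind (fun A => A `<=` vdisk 0 (v u ^+ k))) => [//|A B Ak Bk|i _ x].
    by rewrite subUset.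
  rewrite /D /vdisk /= subr0 => xi.
  have kk1 : v u ^+ k.+1 < v u ^+ k by rewrite exprS gtr_pMl.
  rewrite -[x](subrK (u ^+ k.+1 * rep i)); apply: absvalD_lt; first exact: lt_trans kk1.
  by rewrite absvalM vuk; apply: le_lt_trans kk1; rewrite ler_piMr// ltW.
rewrite measure_bigsetU_ord; first last.
- move=> i j _ _ [x [xi xj]]; apply: rep_inj.
  have := absvalB_lt xj xi; rewrite opprB addrC addrA subrK -mulrBr absvalM vuk.
  by rewrite gtr_pMr.
- by move=> i; exact: measurable_vdisk.
rewrite (eq_bigr (fun=> mu (vdisk 0 (v u ^+ k.+1)))) => [|i _]; last exact: measure_vdisk_center.
by rewrite sumr_const card_ord mule_natl.
Qed.

Lemma measure_vdisk c k : mu (vdisk c (v u ^+ k)) = (q%:R ^- k)%:E.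
Proof.
rewrite measure_vdisk_center; elim: k => [|k]; first by rewrite !expr0 invr1.
have q0 : (0 < q)%N.
  have [|i _] := @rep_surj 0; first by rewrite absval0.
  exact: leq_ltn_trans (ltn_ord i).
rewrite measure_vdisk_step; case: (mu _) => [x| |] //.
- rewrite -EFinM => -[xE]; congr (_%:E).
  by rewrite exprS invfM -xE mulKf// pnatr_eq0 -lt0n.
- by rewrite gt0_muley// lte_fin ltr0n.
- by rewrite gt0_muleNy// lte_fin ltr0n.
Qed.

End ball_measure.
Arguments vdisk {R F} v c r.

(** * Moving averages along Stoltz sequences *)

Lemma eseries_le (R : realType) (t : nat -> R) (C : R) : (forall n, 0 <= t n) ->
  (forall N, \sum_(n < N) t n <= C) -> (\sum_(0 <= n <oo) (t n)%:E <= C%:E)%E.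
Proof.
move=> t0 tC; apply: lime_le; first by apply: is_cvg_nneseries => n _ _; rewrite lee_fin.
by apply: nearW => N; rewrite sumEFin lee_fin big_mkord.
Qed.

Lemma sum_arith_geometric_le (R : realType) (k : R) N : 0 <= k < 1 ->
  \sum_(r < N) r.+1%:R * k ^+ r <= (1 - k) ^- 2.
Proof.
move=> /andP[k0 k1].
have sE : (1 - k) ^+ 2 * \sum_(r < N) r.+1%:R * k ^+ r
    = 1 - k ^+ N * (1 + N%:R * (1 - k)).
  elim: N => [|N IHN]; first by rewrite big_ord0 expr0; ring.
  by rewrite big_ord_recr/= mulrDr IHN [k ^+ N.+1]exprS -natr1; ring.
have k10 : 0 < (1 - k) ^+ 2 by rewrite exprn_gt0// subr_gt0.
rewrite -(ler_pM2l k10) sE divff ?gt_eqF// gerBl.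
by rewrite mulr_ge0 ?exprn_ge0// addr_ge0// mulr_ge0// subr_ge0 ltW.
Qed.

Section stoltz_borel_cantelli.
Context {R : realType} {d : measure_display} {X : measurableType d}.
Context (mu : {measure set X -> \bar R}).

Lemma measure_seq_bigsetU_le (I : Type) (s : seq I) (A : I -> set X) (x : R) :
  (forall i, measurable (A i)) -> (forall i, (mu (A i) <= x%:E)%E) ->
  (mu (\big[setU/set0]_(i <- s) A i) <= ((size s)%:R * x)%:E)%E.
Proof.
move=> mA Ax; elim: s => [|i s IHs]; first by rewrite big_nil measure0 mul0r.
rewrite big_cons; apply: le_trans (measureU2 _ _ _) _ => //.
  by apply: bigsetU_measurable => j _.
by rewrite /= -natr1 mulrDl mul1r addrC EFinD; apply: leeD.
Qed.

(* Slice [r.+1] of the cone contains every [y] with [(y, r)] in [Omega ^ l],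
   so at most [C * r.+1] windows of length [r] have to be discarded. *)
Lemma stoltz_negligible (a b : nat -> nat) (k : R) (D : nat -> nat -> set X) :
  0 <= k < 1 -> stoltz (R := R) a b ->
  (forall y r, exists A, [/\ measurable A, D y r `<=` A & (mu A <= (k ^+ r)%:E)%E]) ->
  mu.-negligible [set x | forall N, exists2 n, (N <= n)%N & D (a n) (b n) x].
Proof.
move=> k01 [ Omega [_ _ Omega_h Omega_l]] Dk.
have [h [h0 hoo hP]] := Omega_h.
have [l [kappa [C [l0 kappa0 C0 CP]]]] := Omega_l.
have kr0 r : 0 <= k ^+ r by case/andP: k01 => ? _; rewrite exprn_ge0.
pose S r := cone_slice Omega l kappa r.+1.
have Sfin r : finite_set (S r) by apply/finite_setP; have [n nS _] := CP r.+1 isT; exists n.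
have Scard r : (size (finmap.enum_fset (fset_set (S r))))%:R <= C * r.+1%:R.
  by have [n nS nC] := CP r.+1 isT; rewrite (card_fset_set nS).
have /choice[A AP] (yr : nat * nat) := Dk yr.1 yr.2.
have mA yr : measurable (A yr) by case: (AP yr).
pose B r := \big[setU/set0]_(y <- finmap.enum_fset (fset_set (S r))) A (`|y|%N, r).
have mB r : measurable (B r) by exact: bigsetU_measurable.
exists (lim_sup_set B); split.
- by apply: bigcapT_measurable => n; exact: bigcup_measurable.
- apply: lim_sup_set_cvg0 => //.
  apply: (@le_lt_trans _ _ (\sum_(0 <= r <oo) (C * (r.+1%:R * k ^+ r))%:E)%E).
    apply: lee_nneseries => // r _.
    apply: le_trans (measure_seq_bigsetU_le (x := k ^+ r) _ _ _) _ => //.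
      by move=> y; case: (AP (`|y|%N, r)).
    by rewrite lee_fin mulrA ler_wpM2r.
  apply: (@le_lt_trans _ _ (C * (1 - k) ^- 2)%:E); last exact: ltry.
  apply: eseries_le => [r|N]; first by rewrite !mulr_ge0// ltW.
  by rewrite -mulr_sumr ler_wpM2l ?(ltW C0)// sum_arith_geometric_le.
- move=> x xD N _.
  (* Exceeding l puts the pair in the part of [Omega] whose cone slices are counted; exceeding N
     makes the window length a witness for the limsup at N. *)
  have [M _ hM] : \forall t \near \oo, Num.max l N%:R <= h t by move/cvgryPge: hoo; exact.
  have [n Mn Dn] := xD M.+1.
  have [On hb] := hP M.+1 n Mn; have /= := hM M.+1 (leqnSn M).
  rewrite ge_max => /andP[lh Nh].
  have Nb : (N <= b n)%N by rewrite -(ler_nat R); apply: le_trans Nh hb.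
  exists (b n) => //.
  have an : (a n)%:Z \in finmap.enum_fset (fset_set (S (b n))).
    rewrite in_fset_set//; apply/mem_set; exists ((a n)%:Z, b n).
      by split=> //; apply: le_trans hb.
    by rewrite /= subrr normr0 mulr0z -addn1 PoszD addrAC subrr add0r mulr1.
  rewrite /B (big_rem _ an)/=; left.
  by case: (AP (a n, b n)) => _ + _; apply.
Qed.

End stoltz_borel_cantelli.

Lemma cvg_ratio (R : realType) (S : nat -> R) (b : nat -> nat) (theta : R) :
  (forall r, 0 < r -> \forall n \near \oo, S n < (theta + r) * (b n)%:R) ->
  (forall r, 0 < r -> \forall n \near \oo, - S n < (- theta + r) * (b n)%:R) ->
  S n / (b n)%:R @[n --> \oo] --> theta.
Proof.
move=> Su Sl; apply/cvgrPdist_lt => r r0.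
apply: filterS2 (Su r r0) (Sl r r0) => n nu nl.
(* At b n = 0 the two strict bounds would read S n < 0 and - S n < 0. *)
have b0 : 0 < (b n)%:R :> R.
  rewrite lt_neqAle ler0n andbT; apply/eqP => b0; move: nu nl.
  by rewrite -b0 !mulr0 oppr_lt0 => /lt_trans h /h; rewrite ltxx.
rewrite distrC ltr_norml; apply/andP; split.
  by rewrite ltrBrDr ltr_pdivlMr//; lra.
by rewrite ltrBlDr ltr_pdivrMr//; lra.
Qed.

Lemma expR_le_inv (R : realType) (s : R) : s < 1 -> expR s <= (1 - s)^-1.
Proof.
move=> s1; rewrite -[s in expR s]opprK expRN lef_pV2 ?posrE ?expR_gt0 ?subr_gt0//.
exact: expR_ge1Dx.
Qed.

(** * Partial quotients are independent *)

Section continued_fraction_cylinders.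
Context {R : realType} {F : fieldType} (v : absvalue R F).
Context (m : nat) (m_gt0 : (0 < m)%N) (u : F).
Hypothesis u_gt0 : 0 < v u.
Hypothesis u_lt1 : v u < 1.
Context (mu : {measure set (borel v) -> \bar R}).
Hypothesis measure_disk : forall c x : F, x != 0 -> v x <= 1 ->
  mu (vdisk v c (v x)) = (v x ^+ m)%:E.

Context (Z : set F) (fl : F -> F).
Hypothesis fl_in : forall x, Z (fl x).
Hypothesis fl_close : forall x, v (x - fl x) < 1.
Hypothesis flD : forall z y, Z z -> v y < 1 -> fl (z + y) = z.

Definition cf_digit (x : F) : F := fl x^-1.
Definition cf_step (x : F) : F := if x == 0 then 0 else x^-1 - fl x^-1.
Local Notation Zst z := (Z z /\ 1 < v z).
Local Notation digit := cf_digit.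
Local Notation T := cf_step.

Context (zs : nat -> F).
Hypothesis zs_in : forall n, Zst (zs n) \/ zs n = 0.
Hypothesis zs_surj : forall z, Zst z -> exists n, zs n = z.
Hypothesis zs_inj : forall n k, zs n = zs k -> zs n != 0 -> n = k.

Definition cylinder_weight (z : F) : R := (v z ^+ (2 * m))^-1.
Local Notation P := cylinder_weight.
Definition cf_branch (z y : F) : F := (z + y)^-1.
Definition cf_word (w : seq F) (y : F) : F := foldr cf_branch y w.

Lemma cylinder_weight_ge0 z : 0 <= P z.
Proof. by rewrite invr_ge0 exprn_ge0// absval_ge0. Qed.

Lemma cylinder_weight0 : P 0 = 0.
Proof. by rewrite /P absval0 expr0n muln_eq0/= (gtn_eqF m_gt0) invr0. Qed.

Lemma absval_branch_arg z y : 1 < v z -> v y < 1 -> v (z + y) = v z.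
Proof. by move=> z1 y1; rewrite absvalD_eq//; apply: lt_trans z1. Qed.

Lemma absval_branch z y : 1 < v z -> v y < 1 -> v (cf_branch z y) = (v z)^-1.
Proof. by move=> z1 y1; rewrite absvalV absval_branch_arg. Qed.

Lemma absval_branch_lt1 z y : 1 < v z -> v y < 1 -> v (cf_branch z y) < 1.
Proof. by move=> z1 y1; rewrite absval_branch// invf_lt1// (lt_trans ltr01). Qed.

Lemma branch_dist z y y' : 1 < v z -> v y < 1 -> v y' < 1 ->
  v (cf_branch z y - cf_branch z y') = v (y - y') * v (z ^- 2).
Proof.
move=> z1 y1 y'1; rewrite /cf_branch.
have z0 : 0 < v z by apply: lt_trans z1.
have n0 x : v x < 1 -> z + x != 0.
  by move=> x1; rewrite -(absval_gt0 v) absval_branch_arg.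
have -> : (z + y)^-1 - (z + y')^-1 = (y' - y) / ((z + y) * (z + y')).
  by field; rewrite !n0.
by rewrite absvalM !absvalV absvalM !(absval_branch_arg z1)// absvalX expr2 absvalB.
Qed.

(** Kept in F so that the contraction ratio of a word is a value of [v], the kind of radius
    [measure_disk] speaks of. *)
Definition cf_scale (w : seq F) : F := \prod_(z <- w) z ^- 2.

Lemma word_dist w y y' : (forall z, z \in w -> 1 < v z) -> v y < 1 -> v y' < 1 ->
  v (cf_word w y - cf_word w y') = v (y - y') * v (cf_scale w) /\ v (cf_word w y) < 1
  /\ v (cf_word w y') < 1.
Proof.
move=> + y1 y'1; elim: w => [|z w IHw] wz.
  by rewrite /cf_scale big_nil absval1 mulr1.
have z1 : 1 < v z by apply: wz; rewrite mem_head.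
have [|IH1 [IH2 IH3]] := IHw.
  by move=> x xw; apply: wz; rewrite in_cons xw orbT.
rewrite /= branch_dist// IH1 /cf_scale big_cons [v (z ^- 2 * _)]absvalM.
by split; [rewrite -mulrA; congr (_ * _); rewrite mulrC|rewrite !absval_branch_lt1].
Qed.

Lemma cf_scale_gt0 w : (forall z, z \in w -> 1 < v z) -> 0 < v (cf_scale w) <= 1.
Proof.
elim: w => [|z w IHw] wz; first by rewrite /cf_scale big_nil absval1 ltr01 lexx.
have z1 : 1 < v z by apply: wz; rewrite mem_head.
have z0 : 0 < v z by apply: lt_trans z1.
have /andP[s0 s1] : 0 < v (cf_scale w) <= 1.
  by apply: IHw => x xw; apply: wz; rewrite in_cons xw orbT.
rewrite /cf_scale big_cons absvalM absvalV absvalX mulr_gt0//= ?invr_gt0 ?exprn_gt0//.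
rewrite mulr_ile1 ?absval_ge0 ?invr_ge0 ?exprn_ge0 ?absval_ge0//.
by rewrite invf_le1 ?exprn_gt0 ?exprn_ege1// ltW.
Qed.

Definition word_weight (w : seq F) : R := \prod_(z <- w) P z.

Lemma cf_scale_weight w : v (cf_scale w) ^+ m = word_weight w.
Proof.
elim: w => [|z w IHw]; first by rewrite /cf_scale /word_weight !big_nil absval1 expr1n.
rewrite /cf_scale /word_weight !big_cons absvalM exprMn -/(cf_scale w) IHw.
by rewrite absvalV absvalX exprVn -exprM.
Qed.

Lemma word_weight_ge0 w : 0 <= word_weight w.
Proof. by apply: prodr_ge0 => z _; exact: cylinder_weight_ge0. Qed.

(* An outer bound [x] on the measure of [E] that holds, rescaled, in every
   cylinder: it is stable under the inverse branches by construction. *)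
Definition cf_bound (E : set F) (x : \bar R) : Prop :=
  forall w, (forall z, z \in w -> 1 < v z) -> exists A : set (borel v),
    [/\ measurable A, cf_word w @` E `<=` A & (mu A <= (word_weight w)%:E * x)%E].

Lemma cf_bound_sub E E' x : E `<=` E' -> cf_bound E' x -> cf_bound E x.
Proof.
move=> EE' E'x w /E'x[A [mA E'A Ax]]; exists A; split=> //.
by move=> _ [y /EE' E'y <-]; apply: E'A; exists y.
Qed.

Lemma cf_bound_le E x x' : (x <= x')%E -> cf_bound E x -> cf_bound E x'.
Proof.
move=> xx' Ex w /Ex[A [mA EA Ax]]; exists A; split=> //.
by apply: le_trans Ax _; rewrite lee_wpmul2l// lee_fin word_weight_ge0.
Qed.

Lemma cf_bound_disk : cf_bound [set y | v y < 1] 1.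
Proof.
move=> w wz; exists (vdisk v (cf_word w 0) (v (cf_scale w))).
have /andP[s0 s1] := cf_scale_gt0 wz.
split; first exact: measurable_vdisk.
  move=> _ [y y1 <-]; rewrite /vdisk /=.
  have [|-> _] := word_dist wz y1 (_ : v 0 < 1); first by rewrite absval0.
  by rewrite subr0 gtr_pMl.
by rewrite mule1 measure_disk ?cf_scale_weight// -(absval_gt0 v).
Qed.

(** Apply the bound for E to the word with z appended: its weight has the extra factor P z. *)
Lemma cf_bound_branch E x z : 1 < v z -> cf_bound E x ->
  cf_bound (cf_branch z @` E) ((P z)%:E * x).
Proof.
move=> z1 Ex w wz; have [|A [mA EA Ax]] := Ex (rcons w z).
  by move=> y; rewrite mem_rcons in_cons => /orP[/eqP ->//|/wz].
exists A; split=> //.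
  move=> _ [_ [y Ey <-] <-]; apply: EA; exists y => //.
  by rewrite /cf_word -cats1 foldr_cat.
rewrite muleA -EFinM; move: Ax; rewrite /word_weight -cats1 big_cat/=.
by rewrite big_seq1.
Qed.

(** Disks shrinking to the image point have measure tending to 0. This disposes of the point 0,
    which has no first digit. *)
Lemma cf_bound_point y : v y < 1 -> cf_bound [set y] 0.
Proof.
move=> y1 w wz; set c := cf_word w y.
exists (\bigcap_k vdisk v c (v u ^+ k)); split.
- by apply: bigcapT_measurable => k; exact: measurable_vdisk.
- by move=> _ [_ -> <-] k _; rewrite /vdisk /= subrr absval0 exprn_gt0.
rewrite mule0; apply/lee_addgt0Pr => r r0; rewrite add0e.
have [N _ /(_ N (leqnn N))] : \forall n \near \oo, v u ^+ m ^+ n < r.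
  apply: (@cvgr_lt _ _ _ _ (fun n => (v u ^+ m) ^+ n) 0) => //.
  apply: cvg_expr; rewrite ger0_norm ?exprn_ge0 ?absval_ge0//.
  by rewrite exprn_ilt1 ?absval_ge0// -lt0n.
move=> /= Nr.
apply: (@le_trans _ _ (mu (vdisk v c (v u ^+ N)))).
  apply: le_measure; rewrite ?inE; [|exact: measurable_vdisk|exact: bigcap_inf].
  by apply: bigcapT_measurable => k; exact: measurable_vdisk.
rewrite -absvalX measure_disk; first by rewrite lee_fin absvalX exprAC ltW.
  by rewrite -(absval_gt0 v) absvalX exprn_gt0.
by rewrite absvalX exprn_ile1 ?ltW.
Qed.

Lemma cf_bound_bigcup (E : nat -> set F) (x : nat -> \bar R) :
  (forall n, 0 <= x n)%E -> (forall n, cf_bound (E n) (x n)) ->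
  cf_bound (\bigcup_n E n) (\sum_(0 <= n <oo) x n)%E.
Proof.
move=> x0 Ex w wz; have /choice[A AP] n := Ex n w wz.
have mA n : measurable (A n) by case: (AP n).
exists (\bigcup_n A n); split.
- exact: bigcup_measurable.
- by move=> _ [y [n _ Eny] <-]; exists n => //; case: (AP n) => _ + _; apply; exists y.
rewrite -nneseriesZl//; apply: (@le_trans _ _ (\sum_(0 <= n <oo) mu (A n))%E).
  by apply: measure_sigma_subadditive => //; exact: bigcup_measurable.
by apply: lee_nneseries => // n _; case: (AP n).
Qed.

Lemma cf_bound_setU E E' (x x' : \bar R) : (0 <= x)%E -> (0 <= x')%E ->
  cf_bound E x -> cf_bound E' x' -> cf_bound (E `|` E') (x + x').
Proof.
move=> x0 x'0 Ex E'x' w wz.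
have [A [mA EA Ax]] := Ex w wz; have [A' [mA' E'A' A'x']] := E'x' w wz.
exists (A `|` A'); split; first exact: measurableU.
  by rewrite image_setU; apply: setUSS.
rewrite ge0_muleDr//; apply: le_trans (leeD Ax A'x').
exact: measureU2.
Qed.

Lemma cf_bound_measurable E x : cf_bound E x ->
  exists A : set (borel v), [/\ measurable A, E `<=` A & (mu A <= x)%E].
Proof.
move=> /(_ [::])[//|A [mA EA]]; rewrite /word_weight big_nil mul1e => Ax.
by exists A; split=> //; apply: subset_trans EA => y Ey; exists y.
Qed.

Lemma absval_cf_map x : v x < 1 -> v (T x) < 1.
Proof. by move=> x1; rewrite /cf_step; case: ifP => _; [rewrite absval0|exact: fl_close]. Qed.

Lemma cf_decomposition x : v x < 1 -> x != 0 ->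
  [/\ Zst (digit x), v x = (v (digit x))^-1 & x = cf_branch (digit x) (T x)].
Proof.
move=> x1 x0; have xV1 : 1 < v x^-1 by rewrite absvalV invf_gt1// absval_gt0.
have dE : v (digit x) = v x^-1.
  by apply: absval_close; apply: lt_trans xV1; exact: fl_close.
split; first by split; [exact: fl_in|rewrite dE].
  by rewrite dE absvalV invrK.
by rewrite /cf_branch /cf_step (negbTE x0) addrC subrK invrK.
Qed.

(** Total probability with respect to the first digit: apart from 0, E is covered by the images of
    the sets G z under the inverse branches. *)
Lemma cf_bound_step (E : set F) (G : F -> set F) (x : F -> \bar R) :
  (forall z, 0 <= x z)%E -> (forall z, Zst z -> cf_bound (G z) (x z)) ->
  (forall y, E y -> v y < 1 /\ (y != 0 -> G (digit y) (T y))) ->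
  cf_bound E (\sum_(0 <= n <oo) (P (zs n))%:E * x (zs n))%E.
Proof.
move=> x0 Gx EG.
have t0 n : (0 <= (P (zs n))%:E * x (zs n))%E.
  by rewrite mule_ge0// lee_fin cylinder_weight_ge0.
have b0 : cf_bound [set 0] 0 by apply: cf_bound_point; rewrite absval0.
(* Where [zs] takes the padding value 0 the weight is 0, so a null set must stand in for the
   branch. *)
pose H n := if zs n == 0 then [set 0] else cf_branch (zs n) @` G (zs n).
apply: (@cf_bound_sub _ ([set 0] `|` \bigcup_n H n)) => [y Ey|].
  have [y1 Gy] := EG _ Ey; have [->|y0] := eqVneq y 0; [by left|right].
  have [dZ _ yE] := cf_decomposition y1 y0; have [n nE] := zs_surj dZ.
  exists n => //; rewrite /H nE ifF; first by exists (T y); [exact: Gy|].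
  apply/eqP => d0; case: dZ => _; rewrite d0 absval0.
  by rewrite ltNge ler01.
rewrite -[X in cf_bound _ X]add0e; apply: cf_bound_setU => //.
  exact: nneseries_ge0.
apply: cf_bound_bigcup => // n; rewrite /H; case: eqVneq => [->|z0].
  by rewrite cylinder_weight0 mul0e.
have [zZ|/eqP] := zs_in n; last by rewrite (negbTE z0).
by apply: cf_bound_branch; [case: zZ|exact: Gx].
Qed.

(** The disk of radius |z|^-2 about 1/z has measure P z, and z is the first digit throughout it.
    These disks are therefore disjoint, and lie in D when z satisfies A. *)
Lemma sum_cylinder_weight_le (A : pred F) (D : set (borel v)) : measurable D ->
  (forall y, v y < 1 -> y != 0 -> A (digit y) -> D y) ->
  forall N, ((\sum_(n < N) (A (zs n))%:R * P (zs n))%:E <= mu D)%E.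
Proof.
move=> mD AD N.
pose B (n : 'I_N) := if (zs n != 0) && A (zs n)
  then vdisk v (zs n)^-1 (v (zs n ^- 2)) else set0.
have BE (n : 'I_N) y : B n y ->
    [/\ zs n != 0, A (zs n), v y < 1, y != 0 & digit y = zs n].
  rewrite /B; case: ifPn => // /andP[z0 Az]; rewrite /vdisk /= => yz.
  have [[zZ z1]|/eqP] := zs_in n; last by rewrite (negbTE z0).
  have vz0 : 0 < v (zs n) by exact: lt_trans z1.
  have vzV : v (zs n ^- 2) < v (zs n)^-1.
    rewrite absvalV absvalX absvalV expr2 invfM gtr_pMr ?invr_gt0//.
    by rewrite invf_lt1.
  have vy : v y = (v (zs n))^-1.
    by rewrite -absvalV; apply: absval_close; rewrite absvalB (lt_trans yz).
  have y0 : y != 0 by rewrite -(absval_gt0 v) vy invr_gt0.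
  split=> //; first by rewrite vy invf_lt1.
  rewrite /cf_digit -[y^-1](subrK (zs n)) addrC flD//.
  (* As |y| = 1/|z|, the last factor has absolute value |z|^2, exactly the inverse of the radius;
     hence y^-1 is within 1 of z. *)
  have -> : y^-1 - zs n = - (y - (zs n)^-1) * (zs n / y) by field; rewrite y0.
  rewrite absvalM absvalN absvalM absvalV vy invrK.
  move: yz; rewrite absvalV absvalX -(ltr_pM2r (exprn_gt0 2 vz0)) mulVf ?expr2//.
  by rewrite gt_eqF// mulr_gt0.
have mB n : measurable (B n).
  by rewrite /B; case: ifP => _; [exact: measurable_vdisk|exact: measurable0].
have -> : (\sum_(n < N) (A (zs n))%:R * P (zs n))%:E = mu (\big[setU/set0]_(n < N) B n).
  rewrite measure_bigsetU_ord//; last first.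
    move=> i j _ _ [y [/BE[i0 _ _ _ yi] /BE[_ _ _ _ yj]]]; apply: val_inj.
    by apply: zs_inj => //; rewrite -yi -yj.
  rewrite -sumEFin; apply: eq_bigr => n _; rewrite /B.
  have [->|z0] := eqVneq (zs n) 0; first by rewrite cylinder_weight0 mulr0 measure0.
  case: ifPn => /= [->|/negPf ->]; last by rewrite mul0r measure0.
  rewrite mul1r measure_disk; first by rewrite absvalV absvalX exprVn -exprM.
    by rewrite invr_neq0// expf_neq0.
  have [[_ z1]|/eqP] := zs_in n; last by rewrite (negbTE z0).
  by rewrite absvalV absvalX invf_le1 ?exprn_gt0 ?exprn_ege1 ?(lt_trans ltr01)// ltW.
apply: le_measure; rewrite ?inE//; first exact: bigsetU_measurable.
apply: (big_ind (fun A => A `<=` D)) => // [A1 A2 ? ?|n _ y /BE[_ Az y1 y0 yE]].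
  by rewrite subUset.
by apply: AD; rewrite // yE.
Qed.

Lemma sum_cylinder_weight_le1 N : \sum_(n < N) P (zs n) <= 1.
Proof.
have mu1 : mu (vdisk v 0 1) = 1%E.
  by have := measure_disk 0 (oner_neq0 F); rewrite absval1 lexx expr1n; apply.
have := @sum_cylinder_weight_le predT _ (@measurable_vdisk _ _ v 0 1) _ N.
rewrite mu1 lee_fin; under eq_bigr do rewrite mul1r.
by apply=> y y1 _ _; rewrite /vdisk /= subr0.
Qed.

(** * Large deviations and almost sure averages *)

Definition cf_sum (g : F -> R) (r : nat) (x : F) : R :=
  \sum_(j < r) g (digit (iter j T x)).

Lemma cf_sumS g r x : cf_sum g r.+1 x = g (digit x) + cf_sum g r (T x).
Proof.
rewrite /cf_sum big_ord_recl; congr (_ + _).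
by apply: eq_bigr => j _; rewrite lift0 iterSr.
Qed.

(** Induction on r: fixing the first digit z lowers the threshold to t - g z, which costs a factor
    e^(s g z), and the weighted sum of these factors is at most rho. For r = 0 the claim is Markov's
    step 1_(t <= 0) <= e^(-s t). *)
Lemma cf_bound_chernoff (g : F -> R) (s rho t : R) r : 0 <= s ->
  (forall N, \sum_(n < N) P (zs n) * expR (s * g (zs n)) <= rho) ->
  cf_bound [set x | v x < 1 /\ t <= cf_sum g r x] (rho ^+ r * expR (- (s * t)))%:E.
Proof.
move=> s0 Prho; have rho0 : 0 <= rho by have := Prho 0%N; rewrite big_ord0.
elim: r t => [|r IHr] t.
  rewrite expr0 mul1r; have [t0|t0] := leP t 0.
    apply: (cf_bound_le _ (cf_bound_sub _ cf_bound_disk)); last by move=> x [].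
    by rewrite lee_fin -expR0 ler_expR oppr_ge0 mulr_ge0_le0.
  apply: (@cf_bound_sub _ (\bigcup_(n : nat) set0)) => [x [_]|].
    by rewrite /cf_sum big_ord0 leNgt t0.
  apply: (cf_bound_le _ (cf_bound_bigcup (x := fun=> 0%E) _ _)) => // [|_ w _].
    by rewrite eseries0// lee_fin expR_ge0.
  by exists set0; split; rewrite ?image_set0 ?measure0 ?mule0.
pose G z := [set x | v x < 1 /\ t - g z <= cf_sum g r x].
pose y z : \bar R := (rho ^+ r * expR (- (s * (t - g z))))%:E.
apply: cf_bound_le (@cf_bound_step _ G y _ _ _); last 3 first.
- by move=> z; rewrite lee_fin mulr_ge0 ?exprn_ge0 ?expR_ge0.
- by move=> z _; exact: IHr.
- move=> x [x1]; rewrite cf_sumS => tx; split=> // _; split; first exact: absval_cf_map.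
  by rewrite lerBlDl.
have yE n : ((P (zs n))%:E * y (zs n))%E
    = (rho ^+ r * expR (- (s * t)) * (P (zs n) * expR (s * g (zs n))))%:E.
  by rewrite /y -EFinM mulrBr opprB addrC expRD; congr (_%:E); ring.
rewrite (eq_eseriesr (fun n _ => yE n)); apply: eseries_le => [n|N].
  by rewrite !mulr_ge0 ?exprn_ge0 ?expR_ge0 ?cylinder_weight_ge0.
rewrite -mulr_sumr exprSr [leRHS]mulrAC ler_wpM2l//.
by rewrite mulr_ge0 ?exprn_ge0 ?expR_ge0.
Qed.

(** One-sided form of the invariance of mu under T: whatever the first digit, the rest obeys the
    same bound, and the weights add up to at most 1. *)
Lemma cf_bound_shift (E : set F) (x : R) n : 0 <= x -> cf_bound E x%:E ->
  cf_bound [set y | v y < 1 /\ E (iter n T y)] x%:E.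
Proof.
move=> x0 Ex; elim: n => [|n IHn].
  by apply: cf_bound_sub Ex => y [].
apply: cf_bound_le (@cf_bound_step _
  (fun=> [set y | v y < 1 /\ E (iter n T y)]) (fun=> x%:E) _ _ _); last 3 first.
- by move=> _; rewrite lee_fin.
- by [].
- move=> y [y1]; rewrite iterSr => Ey; split=> // _; split=> //.
  exact: absval_cf_map.
have -> : (\sum_(0 <= n <oo) (P (zs n))%:E * x%:E = \sum_(0 <= n <oo) (P (zs n) * x)%:E)%E by [].
apply: eseries_le => [k|N]; first by rewrite mulr_ge0// cylinder_weight_ge0.
by rewrite -mulr_suml ler_piMl// sum_cylinder_weight_le1.
Qed.

(** The strict inequality on rho makes the Chernoff bound geometric in the window length, with ratio
    rho e^(-s (theta + r)) below 1, as [stoltz_negligible] requires. *)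
Lemma cf_slln_upper (g : F -> R) (theta : R) (a b : nat -> nat) :
  stoltz (R := R) a b ->
  (forall r, 0 < r -> exists s rho : R, [/\ 0 <= s,
    forall N, \sum_(n < N) P (zs n) * expR (s * g (zs n)) <= rho &
    rho < expR (s * (theta + r))]) ->
  {ae mu, forall x, v x < 1 -> forall r, 0 < r -> \forall n \near \oo,
    cf_sum g (b n) (iter (a n) T x) < (theta + r) * (b n)%:R}.
Proof.
move=> abS gP.
(* Restricting the margin to 1/(i+1) leaves countably many exceptional null sets. *)
pose Q (i : nat) (x : F) := v x < 1 -> \forall n \near \oo,
  cf_sum g (b n) (iter (a n) T x) < (theta + i.+1%:R^-1) * (b n)%:R.
suff : {ae mu, forall x i, Q i x}.
  apply: (@filterS _ _ (ae_filter_ringOfSetsType mu)) => x xQ x1 r r0.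
  have [i ir] : exists i : nat, i.+1%:R^-1 < r.
    exists (Num.bound r^-1); rewrite invf_plt ?posrE//.
    by apply: lt_trans (archi_boundP _) _; rewrite ?invr_ge0 ?ltW// ltr_nat.
  apply: filterS (xQ i x1) => n /lt_le_trans; apply.
  by rewrite ler_wpM2r// lerD2l ltW.
apply: ae_foralln => i.
have [|s [rho [s0 Prho rhos]]] := gP i.+1%:R^-1; first by rewrite invr_gt0.
have rho0 : 0 <= rho by have := Prho 0%N; rewrite big_ord0.
set t := theta + i.+1%:R^-1 in rhos *.
pose D y r : set (borel v) := [set x : F | v x < 1 /\
  (v (iter y T x) < 1 /\ t * r%:R <= cf_sum g r (iter y T x))].
have : mu.-negligible [set x | forall N, exists2 n, (N <= n)%N & D (a n) (b n) x].
  apply: (stoltz_negligible (k := rho * expR (- (s * t))) _ abS).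
    by rewrite mulr_ge0 ?expR_ge0//= expRN ltr_pdivrMr ?expR_gt0// mul1r.
  move=> y r; apply: cf_bound_measurable.
  rewrite exprMn -expRM_natl mulrN mulrA [_ * s]mulrC -mulrA [_ * t]mulrC.
  apply: (@cf_bound_shift [set x | v x < 1 /\ t * r%:R <= cf_sum g r x]).
    by rewrite mulr_ge0 ?exprn_ge0 ?expR_ge0.
  exact: cf_bound_chernoff.
apply: negligibleS => x /= /not_implyP[x1 xn] N; apply: contrapT => nD; apply: xn.
exists N => // n /= Nn; rewrite ltNge; apply/negP => bad; apply: nD; exists n => //.
split=> //; split=> //.
by elim: (a n) => //= y; exact: absval_cf_map.
Qed.

Lemma sum_indicator_expR_le (A : pred F) (theta s : R) : 0 <= s ->
  (forall N, \sum_(n < N) (A (zs n))%:R * P (zs n) <= theta) ->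
  forall N, \sum_(n < N) P (zs n) * expR (s * (A (zs n))%:R)
    <= 1 + (expR s - 1) * theta.
Proof.
move=> s0 Ath N.
rewrite (eq_bigr (fun n : 'I_N => P (zs n) + (expR s - 1) * ((A (zs n))%:R * P (zs n)))).
  rewrite big_split/= -mulr_sumr lerD ?sum_cylinder_weight_le1// ler_wpM2l ?Ath//.
  by rewrite subr_ge0 -expR0 ler_expR.
move=> n _; case: (A (zs n)); first by rewrite /= mulr1n !mulr1; ring.
by rewrite /= mulr0n !mulr0 expR0; ring.
Qed.

Lemma indicator_mgf (A : pred F) (theta : R) : theta <= 1 ->
  (forall N, \sum_(n < N) (A (zs n))%:R * P (zs n) <= theta) ->
  forall r, 0 < r -> exists s rho : R, [/\ 0 <= s,
    forall N, \sum_(n < N) P (zs n) * expR (s * (A (zs n))%:R) <= rho &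
    rho < expR (s * (theta + r))].
Proof.
move=> th1 Ath r r0; have th0 : 0 <= theta by have := Ath 0%N; rewrite big_ord0.
(* Since e^s - 1 <= s / (1 - s) and 1 + x <= e^x, it suffices that theta / (1 - s) < theta + r, that
   is s (theta + r) < r. As theta <= 1, taking s (1 + r) = r / 2 is enough. *)
pose s := r / (2 * (1 + r)).
have s0 : 0 < s by rewrite divr_gt0// mulr_gt0// addr_gt0.
have sr : s * (1 + r) = r / 2 by rewrite /s; field; rewrite gt_eqF// addr_gt0.
have s1 : s < 1 by rewrite ltr_pdivrMr ?mulr_gt0 ?addr_gt0//; lra.
exists s, (1 + (expR s - 1) * theta); split; first exact: ltW.
  exact/sum_indicator_expR_le/Ath/ltW.
apply: lt_le_trans (expR_ge1Dx _); rewrite ltrD2l.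
apply: (@le_lt_trans _ _ (s / (1 - s) * theta)).
  rewrite ler_wpM2r// lerBlDr (le_trans (expR_le_inv s1))//.
  by rewrite le_eqVlt; apply/orP; left; apply/eqP; field; lra.
rewrite mulrAC ltr_pdivrMr ?subr_gt0// -(mulrA s) ltr_pM2l//.
suff : s * (theta + r) < r by lra.
apply: (@le_lt_trans _ _ (s * (1 + r))); last by rewrite sr; lra.
by rewrite ler_wpM2l ?(ltW s0)// lerD2r.
Qed.

(** The second hypothesis bounds the frequency of the complement by 1 - theta, which is the lower
    bound for A. *)
Lemma cf_frequency (A : pred F) (theta : R) (a b : nat -> nat) :
  stoltz (R := R) a b ->
  (forall N, \sum_(n < N) (A (zs n))%:R * P (zs n) <= theta) ->
  (forall N, \sum_(n < N) (~~ A (zs n))%:R * P (zs n) <= 1 - theta) ->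
  {ae mu, forall x, v x < 1 ->
    cf_sum (fun y => (A y)%:R) (b n) (iter (a n) T x) / (b n)%:R @[n --> \oo] --> theta}.
Proof.
move=> abS Ath nAth.
have th0 : 0 <= theta by have := Ath 0%N; rewrite big_ord0.
have th1 : theta <= 1 by have := nAth 0%N; rewrite big_ord0 subr_ge0.
have nth1 : 1 - theta <= 1 by rewrite gerBl.
have Au := @cf_slln_upper (fun y => (A y)%:R) _ _ _ abS (@indicator_mgf A _ th1 Ath).
have nAu := @cf_slln_upper (fun y => (predC A y)%:R) _ _ _ abS
  (@indicator_mgf (predC A) _ nth1 nAth).
apply: (@filterS2 _ _ (ae_filter_ringOfSetsType mu)) Au nAu => x xu xl x1.
apply: cvg_ratio => r r0; first exact: xu x1 r r0.
apply: filterS (xl x1 r r0) => n.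
suff -> : cf_sum (fun y => (predC A y)%:R) (b n) (iter (a n) T x)
    = (b n)%:R - cf_sum (fun y => (A y)%:R) (b n) (iter (a n) T x) by lra.
rewrite /cf_sum -[X in X%:R]card_ord -sumr_const -sumrB; apply: eq_bigr => j _ /=.
by case: (A (digit (iter j T (iter (a n) T x)))); rewrite ?subrr ?subr0.
Qed.

Lemma cf_digit_frequency (i : nat) (a b : nat -> nat) : stoltz (R := R) a b ->
  zs i != 0 -> {ae mu, forall x, v x < 1 ->
    cf_sum (fun y => (y == zs i)%:R) (b n) (iter (a n) T x) / (b n)%:R
      @[n --> \oo] --> P (zs i)}.
Proof.
move=> abS zi0.
(* Extends a partial sum until it contains index i, whose term can then be isolated even when i >=
   N. *)
have widen (G : nat -> R) N : (forall n, 0 <= G n) ->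
    \sum_(n < N) G n <= G i + \sum_(n < N + i.+1 | n != i :> nat) G n.
  move=> G0; have iN : (i < N + i.+1)%N by rewrite addnS ltnS leq_addl.
  rewrite (big_ord_widen _ G (leq_addr i.+1 N)) [leRHS](_ : _ = \sum_(n < N + i.+1) G n).
    by rewrite [leRHS](bigID (fun n : 'I__ => (n < N)%N))/= lerDl sumr_ge0.
  by rewrite [RHS](bigD1 (Ordinal iN))//=.
have zsE n : (zs n == zs i) = (n == i).
  by apply/eqP/eqP => [/esym/zs_inj/(_ zi0)|->].
apply: (@cf_frequency (fun y => y == zs i)) => // N.
  have G0 n : 0 <= (zs n == zs i)%:R * P (zs n) by rewrite mulr_ge0 ?cylinder_weight_ge0.
  apply: le_trans (widen _ _ G0) _; rewrite eqxx mul1r big1 ?addr0// => n ni.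
  by rewrite zsE (negbTE ni) mul0r.
have G0 n : 0 <= (zs n != zs i)%:R * P (zs n) by rewrite mulr_ge0 ?cylinder_weight_ge0.
apply: le_trans (widen _ _ G0) _; rewrite eqxx mul0r add0r lerBrDl.
have iN : (i < N + i.+1)%N by rewrite addnS ltnS leq_addl.
rewrite (eq_bigr (fun n : 'I__ => P (zs n))) => [|n ni]; last by rewrite zsE ni mul1r.
apply: le_trans (sum_cylinder_weight_le1 (N + i.+1)).
by rewrite [leRHS](bigD1 (Ordinal iN)).
Qed.

(** * The law of the level of a partial quotient *)

Context (q : R).
Hypothesis q_gt1 : 1 < q.
Hypothesis u_pow : v u ^+ m = q^-1.
Hypothesis v_discrete : forall x, x != 0 -> v x < 1 ->
  exists2 l, (0 < l)%N & v x = v u ^+ l.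

(** This is the l with v z = |u|^-l when there is one; the logarithmic form makes it proportional to
    [valuation]. *)
Definition cf_level (z : F) : R := - (ln (v z) / ln (v u)).

Lemma cf_levelE z l : v z = v u ^- l -> cf_level z = l%:R.
Proof.
rewrite /cf_level => ->; rewrite lnV ?posrE ?exprn_gt0// lnXn//.
rewrite mulNr opprK -(mulr_natr (ln _)) mulrAC divff ?mul1r//.
by rewrite lt_eqF// ln_lt0// u_gt0.
Qed.

Lemma measure_level_disk k : mu (vdisk v 0 (v u ^+ k)) = (q ^- k)%:E.
Proof.
rewrite -absvalX measure_disk; first by rewrite absvalX exprAC u_pow exprVn.
  by rewrite -(absval_gt0 v) absvalX exprn_gt0.
by rewrite absvalX exprn_ile1 ?ltW.
Qed.

(** As |digit y| = 1/|y|, the left side says |y| <= |u|^l. By discreteness this is an open disk one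
    level up, hence [l.-1]. *)
Lemma level_disk l y : (0 < l)%N -> v y < 1 -> y != 0 ->
  (v u ^- l <= v (digit y)) = (v y < v u ^+ l.-1).
Proof.
move=> l0 y1 y0; have [_ yE _] := cf_decomposition y1 y0.
have [k k0 yk] := v_discrete y0 y1.
have -> : v (digit y) = v u ^- k by rewrite -yk yE invrK.
rewrite yk lef_pV2 ?posrE ?exprn_gt0// ler_iXn2l// ltr_iXn2l//.
by case: l l0.
Qed.

Lemma measure_annulus i j : (i <= j)%N ->
  mu (vdisk v 0 (v u ^+ i) `\` vdisk v 0 (v u ^+ j)) = (q ^- i - q ^- j)%:E.
Proof.
move=> ij; rewrite EFinB -!measure_level_disk measureD; [|exact: measurable_vdisk..|].
  rewrite setIidr//.
  move=> y; rewrite /vdisk /= => /lt_le_trans; apply.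
  by rewrite ler_iXn2l.
by apply: (@le_lt_trans _ _ (q ^- i)%:E); rewrite -?measure_level_disk// measure_level_disk ltry.
Qed.

Lemma sum_level_ge_le l : (0 < l)%N ->
  forall N, \sum_(n < N) (v u ^- l <= v (zs n))%R%:R * P (zs n) <= q ^- l.-1.
Proof.
move=> l0 N; rewrite -lee_fin -measure_level_disk.
apply: (sum_cylinder_weight_le (A := fun z => v u ^- l <= v z)); first exact: measurable_vdisk.
by move=> y y1 y0; rewrite level_disk// /vdisk /= subr0.
Qed.

Lemma sum_level_lt_le l : (0 < l)%N ->
  forall N, \sum_(n < N) (~~ (v u ^- l <= v (zs n)))%R%:R * P (zs n) <= 1 - q ^- l.-1.
Proof.
move=> l0 N; rewrite -lee_fin -[X in X - _]invr1 -(expr0 q) -measure_annulus//.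
apply: (sum_cylinder_weight_le (A := fun z => ~~ (v u ^- l <= v z))).
  by apply: measurableD; exact: measurable_vdisk.
by move=> y y1 y0; rewrite level_disk// /vdisk /= subr0 expr0 => /negP.
Qed.

Lemma cf_level_frequency (a b : nat -> nat) : stoltz (R := R) a b ->
  {ae mu, forall x, v x < 1 -> forall l, (0 < l)%N ->
    cf_sum (fun y => (v u ^- l <= v y)%R%:R) (b n) (iter (a n) T x) / (b n)%:R
      @[n --> \oo] --> q ^- l.-1}.
Proof.
move=> abS.
suff : {ae mu, forall x l, v x < 1 ->
    cf_sum (fun y => (v u ^- l.+1 <= v y)%R%:R) (b n) (iter (a n) T x) / (b n)%:R
      @[n --> \oo] --> q ^- l}.
  by apply: (@filterS _ _ (ae_filter_ringOfSetsType mu)) => x xP x1 [|l]// _; exact: xP.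
apply: ae_foralln => l.
apply: (@cf_frequency (fun y => v u ^- l.+1 <= v y)) => //.
  exact: (@sum_level_ge_le l.+1).
exact: (@sum_level_lt_le l.+1).
Qed.

Lemma sum_level_eq_le l : (0 < l)%N ->
  forall N, \sum_(n < N) (v (zs n) == v u ^- l)%:R * P (zs n) <= q ^- l.-1 - q ^- l.
Proof.
move=> l0 N; rewrite -lee_fin -measure_annulus ?leq_pred//.
apply: (sum_cylinder_weight_le (A := fun z => v z == v u ^- l)).
  by apply: measurableD; exact: measurable_vdisk.
move=> y y1 y0 /eqP yl; have := level_disk l0 y1 y0; rewrite yl lexx => /esym yl1.
have := level_disk (ltn0Sn l) y1 y0; rewrite yl/= lef_pV2 ?posrE ?exprn_gt0//.
rewrite ler_iXn2l// ltnn => /esym/negbT yl2.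
by rewrite /vdisk /= !subr0; split=> //; apply/negP.
Qed.

(** The level is geometric: by [sum_level_eq_le], level l has mass at most (q - 1) q^-l. Weighting
    by e^(s l) and summing over l >= 1 gives the right-hand side. *)
Lemma level_mgf_le (s : R) : expR s < q -> forall N,
  \sum_(n < N) P (zs n) * expR (s * cf_level (zs n))
    <= (q - 1) * expR s / (q - expR s).
Proof.
move=> sq N; set y := expR s in sq *.
have y0 : 0 < y by exact: expR_gt0.
have q0 : 0 < q by exact: lt_trans q_gt1.
have /choice[lev levP] n : exists l, zs n != 0 -> (0 < l)%N /\ v (zs n) = v u ^- l.
  have [[_ z1]|->] := zs_in n; last by exists 0%N; rewrite eqxx.
  have z0 : zs n != 0 by rewrite -(absval_gt0 v) (lt_trans ltr01).
  have [|l l0 zl] := v_discrete (invr_neq0 z0).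
    by rewrite absvalV invf_lt1 ?(lt_trans ltr01).
  by exists l => _; split=> //; rewrite -zl absvalV invrK.
(* No level among the first N entries exceeds M, so grouping by level gives a finite double sum. *)
pose M := \max_(n < N) lev n.
apply: (@le_trans _ _ (\sum_(n < N) \sum_(l < M)
    y ^+ l.+1 * ((v (zs n) == v u ^- l.+1)%:R * P (zs n)))).
  apply: ler_sum => n _; have t0 (l : 'I_M) :
      0 <= y ^+ l.+1 * ((v (zs n) == v u ^- l.+1)%:R * P (zs n)).
    by rewrite !mulr_ge0 ?cylinder_weight_ge0// exprn_ge0// ltW.
  have [->|z0] := eqVneq (zs n) 0.
    by rewrite cylinder_weight0 mul0r sumr_ge0// => l _; rewrite !mulr_ge0// exprn_ge0// ltW.
  have [l0 zl] := levP _ z0.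
  have lM : ((lev n).-1 < M)%N by rewrite prednK// (leq_bigmax n).
  rewrite (bigD1 (Ordinal lM))//= prednK// -zl eqxx mul1r (cf_levelE zl).
  by rewrite [s * _]mulrC expRM_natl mulrC lerDl sumr_ge0.
rewrite exchange_big/=.
apply: (@le_trans _ _ (\sum_(l < M) (q - 1) * (y / q) * (y / q) ^+ l)).
  apply: ler_sum => l _; rewrite -mulr_sumr.
  apply: le_trans (ler_wpM2l _ (sum_level_eq_le (ltn0Sn l) N)) _.
    by rewrite exprn_ge0// ltW.
  rewrite le_eqVlt; apply/orP; left; apply/eqP => /=.
  by rewrite expr_div_n !exprS; field; rewrite ?expf_neq0 ?gt_eqF.
rewrite -mulr_sumr; set x := y / q.
have x1 : x < 1 by rewrite ltr_pdivrMr// mul1r.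
have -> : (q - 1) * y / (q - y) = (q - 1) * x * (1 - x)^-1.
  by rewrite /x; field; rewrite gt_eqF// subr_eq0 gt_eqF.
rewrite ler_wpM2l ?mulr_ge0 ?subr_ge0 ?(ltW q_gt1) ?invr_ge0 ?(ltW y0) ?(ltW q0)//.
rewrite -[leRHS]mul1r ler_pdivlMr ?subr_gt0// mulrC.
have -> : (1 - x) * (\sum_(l < M) x ^+ l) = 1 - x ^+ M.
  by rewrite -[1 - x]opprB mulNr -subrX1 opprB.
by rewrite gerBl exprn_ge0// divr_ge0 ?ltW.
Qed.

Local Notation c := (q / (q - 1)).

(** The bound is the moment generating function of the exponential law with the same mean c. It
    follows from (1 - s) e^s <= 1, true for s of either sign, so one estimate serves both tails. *)
Lemma level_mgf_le_inv (s : R) : s * c < 1 -> forall N,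
  \sum_(n < N) P (zs n) * expR (s * cf_level (zs n)) <= (1 - s * c)^-1.
Proof.
move=> sc N; have q10 : 0 < q - 1 by rewrite subr_gt0.
have cE : s * c * (q - 1) = s * q by rewrite -mulrA divfK// gt_eqF.
have es1 : (1 - s) * expR s <= 1.
  have := ler_wpM2r (ltW (expR_gt0 s)) (expR_ge1Dx (- s)).
  by rewrite -expRD addNr expR0.
have le : (q - 1) * expR s * (1 - s * c) <= q - expR s.
  have -> : (q - 1) * expR s * (1 - s * c)
      = q * ((1 - s) * expR s) - expR s.
    transitivity (expR s * ((q - 1) - s * c * (q - 1))); first by ring.
    by rewrite cE; ring.
  by rewrite lerD2r ler_piMr// ltW// (lt_trans ltr01).
have sq : 0 < q - expR s.
  by apply: lt_le_trans le; rewrite !mulr_gt0 ?expR_gt0// subr_gt0.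
rewrite subr_gt0 in sq; apply: le_trans (level_mgf_le sq N) _.
by rewrite ler_pdivrMr ?subr_gt0// ler_pdivlMl ?subr_gt0// mulrC.
Qed.

Lemma level_mgf r : 0 < r ->
  (exists s rho : R, [/\ 0 <= s,
    forall N, \sum_(n < N) P (zs n) * expR (s * cf_level (zs n)) <= rho &
    rho < expR (s * (c + r))]) /\
  (exists s rho : R, [/\ 0 <= s,
    forall N, \sum_(n < N) P (zs n) * expR (s * - cf_level (zs n)) <= rho &
    rho < expR (s * (- c + r))]).
Proof.
move=> r0; have c0 : 0 < c by rewrite divr_gt0 ?subr_gt0 ?(lt_trans ltr01).
have := level_mgf_le_inv; move: (c) c0 => d d0 mgf_le.
have cr0 : 0 < d + r by rewrite addr_gt0.
(* With 1 + x <= e^x, the upper tail reduces to s d (d + r) < r and the lower one to s d (d - r) <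
   r. This choice makes the first left side r / 2, and the second is no larger. *)
pose s := r / (2 * (d * (d + r))).
have s0 : 0 < s by rewrite divr_gt0// !mulr_gt0.
have sE : s * d * (d + r) = r / 2.
  by rewrite /s; field; rewrite !gt_eqF.
have sc : s * d < 1.
  by rewrite -(ltr_pM2r cr0) sE mul1r; lra.
have sc0 : 0 < s * d by rewrite mulr_gt0.
split.
  exists s, (1 - s * d)^-1; split; [exact: ltW|exact: mgf_le|].
  apply: lt_le_trans (expR_ge1Dx _).
  rewrite -[ltLHS]mul1r ltr_pdivrMr ?subr_gt0//.
  suff : 0 < s * (r - s * d * (d + r)) by lra.
  by rewrite mulr_gt0// sE; lra.
exists s, (1 - (- s) * d)^-1; split; first exact: ltW.
  move=> N; have := mgf_le (- s) _ N; rewrite mulNr.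
  under eq_bigr do rewrite mulNr -mulrN.
  by apply; rewrite (lt_trans _ ltr01)// oppr_lt0.
apply: lt_le_trans (expR_ge1Dx _).
rewrite -[ltLHS]mul1r mulNr opprK ltr_pdivrMr ?addr_gt0//.
suff : 0 < s * (r - s * d * (d - r)) by lra.
rewrite mulr_gt0// subr_gt0; apply: (@le_lt_trans _ _ (s * d * (d + r))).
  by rewrite ler_wpM2l ?(ltW sc0)// lerD2l; lra.
by rewrite sE; lra.
Qed.

Lemma cf_level_average (a b : nat -> nat) : stoltz (R := R) a b ->
  {ae mu, forall x, v x < 1 ->
    cf_sum cf_level (b n) (iter (a n) T x) / (b n)%:R @[n --> \oo] --> c}.
Proof.
move=> abS.
have lu := @cf_slln_upper cf_level c _ _ abS (fun r r0 => (level_mgf r0).1).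
have ll := @cf_slln_upper (fun z => - cf_level z) (- c) _ _ abS (fun r r0 => (level_mgf r0).2).
apply: (@filterS2 _ _ (ae_filter_ringOfSetsType mu)) lu ll => x xu xl x1.
apply: cvg_ratio => r r0; first exact: xu.
apply: filterS (xl x1 r r0) => n.
by rewrite /cf_sum sumrN.
Qed.

End continued_fraction_cylinders.

(** * The continued fraction over the extension *)

(* Indices that are no code are sent to 0, whose cylinder weight is the junk
   value 0^-1 = 0. *)
Lemma code_enumeration (F : fieldType) (S : set F) (code : F -> nat) :
  {in S &, injective code} -> exists zs : nat -> F,
  [/\ forall n, S (zs n) \/ zs n = 0, forall z, S z -> exists n, zs n = z &
    forall n k, zs n = zs k -> zs n != 0 -> n = k].
Proof.
move=> codeI; pose zs n := xget 0 [set z | S z /\ code z = n].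
have zsP n : (S (zs n) /\ code (zs n) = n) \/ zs n = 0.
  by rewrite /zs; case: xgetP => [z _ ?|]; [left|right].
exists zs; split=> [n|z Sz|n k nk n0].
- by case: (zsP n) => [[]|]; [left|right].
- exists (code z); apply: xget_unique => // y [Sy yz].
  by apply: codeI; rewrite ?inE.
- have [[_ <-]|/eqP] := zsP n; last by rewrite (negbTE n0).
  have [[_ <-]|/eqP] := zsP k; last by rewrite -nk (negbTE n0).
  by rewrite nk.
Qed.

Lemma frequency_cf_sum (R : realType) (F : fieldType) (fl : F -> F) (A : pred F)
    (x : F) (a b : nat) :
  frequency (fun k => A (fl (iter k.-1 (cf_step fl) x)^-1)) a b
    = cf_sum fl (fun y => (A y)%:R) b (iter a (cf_step fl) x) / b%:R :> R.
Proof.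
rewrite /frequency /cf_sum; congr (_ / _).
have -> : iota 1 b = index_iota 1 b.+1 by rewrite /index_iota subn1.
rewrite -sum1_count big_mkcond natr_sum.
rewrite big_add1/= big_mkord; apply: eq_bigr => j _.
by rewrite addnS/= addnC iterD /cf_digit; case: (A _).
Qed.

Lemma cf_sumB (R : realType) (F : fieldType) (fl : F -> F) (g h : F -> R) r x :
  cf_sum fl (fun y => g y - h y) r x = cf_sum fl g r x - cf_sum fl h r x.
Proof. by rewrite /cf_sum sumrB. Qed.

Section haar_measure.
Context {R : realType} (p : nat) (p_prime : prime p).
Context {Qp : fieldType} (vQ : absvalue R Qp) (QpP : is_Qp p vQ).
Context {K : fieldExtType Qp} (vK : absvalue R K).
Context (vKQ : forall x : Qp, vK x%:A = vQ x).
Context (e f : nat) (eE : ramification_index vQ vK {:K}%AS e).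
Context (fE : residue_degree vQ vK {:K}%AS f).
Context (gamma : K) (gamma_prim : (p ^ f - 1)%N.-primitive_root gamma).
Context (beta : K) (beta_abs : vK beta = p%:R `^ (e%:R^-1)).
Context (mu : {measure set (borel vK) -> \bar R}) (mu_haar : is_haar mu).
Context (mu_ball : mu [set x : K | vK x < 1] = 1%E).

Local Notation b := (p%:R `^ (e%:R^-1) : R).

Lemma absval_uniformizer : vK beta^-1 = b^-1.
Proof. by rewrite absvalV beta_abs. Qed.

Lemma ramification_base_gt1 : 1 < b.
Proof.
have e0 := ramification_gt0 eE; rewrite ltNge; apply/negP => b1.
have : 1 < p%:R :> R by rewrite ltr1n prime_gt1.
by rewrite -(ramification_pow p eE) ltNge exprn_ile1 ?powR_ge0.
Qed.

Lemma absval_uniformizer_gt0 : 0 < vK beta^-1.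
Proof. by rewrite absval_uniformizer invr_gt0 (lt_trans ltr01) ?ramification_base_gt1. Qed.

Lemma absval_uniformizer_lt1 : vK beta^-1 < 1.
Proof.
have b1 := ramification_base_gt1.
by rewrite absval_uniformizer invf_lt1// (lt_trans ltr01).
Qed.

Lemma absval_uniformizer_pow : vK beta^-1 ^+ (e * f) = (p ^ f)%:R^-1.
Proof.
by rewrite absval_uniformizer exprVn exprM (ramification_pow p eE) natrX.
Qed.

Lemma value_le1 x : x != 0 -> vK x <= 1 -> exists l, vK x = vK beta^-1 ^+ l.
Proof.
move=> x0; have [k ->] := value_group p_prime QpP eE beta_abs x0.
have b1 := ramification_base_gt1.
rewrite -[leRHS](expr0z b) ler_eXz2l// => k0; exists `|k|%N.
have kE : k = - (`|k|%N : int) by rewrite abszE ler0_norm// opprK.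
by rewrite absval_uniformizer exprVn {1}kE exprnN.
Qed.

Lemma value_lt1 x : x != 0 -> vK x < 1 ->
  exists2 l, (0 < l)%N & vK x = vK beta^-1 ^+ l.
Proof.
move=> x0 x1; have [[|l] xl] := value_le1 x0 (ltW x1); last by exists l.+1.
by move: x1; rewrite xl expr0 ltxx.
Qed.

Lemma value_level_mono k l y : (k <= l)%N ->
  vK beta^-1 ^- l <= vK y -> vK beta^-1 ^- k <= vK y.
Proof.
move=> kl; apply: le_trans; rewrite lef_pV2 ?posrE ?exprn_gt0 ?absval_uniformizer_gt0//.
by rewrite ler_wiXn2l// ?ltW ?absval_uniformizer_gt0 ?absval_uniformizer_lt1.
Qed.

(** The value group is generated by |beta|, so no value lies strictly between consecutive levels;
    exact counts become differences of tail counts. *)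
Lemma value_eq_level l y :
  (vK y == vK beta^-1 ^- l)
    = (vK beta^-1 ^- l <= vK y) && ~~ (vK beta^-1 ^- l.+1 <= vK y).
Proof.
have b1 := ramification_base_gt1; have b0 : 0 < b by exact: lt_trans b1.
rewrite absval_uniformizer !exprVn !invrK.
have [->|y0] := eqVneq y 0.
  by rewrite absval0 lt_eqF ?exprn_gt0// leNgt exprn_gt0.
have [k ->] := value_group p_prime QpP eE beta_abs y0.
rewrite !exprnP !ler_eXz2l// (inj_eq (ieexprIz b0 (negbT (gt_eqF b1)))).
by rewrite -ltNge intS addrC ltzD1 eq_le andbC.
Qed.

(** The uniformizer is [beta^-1] and the digit sums are the p^f representatives. Each level divides
    the measure by p^f, and p^-f is |beta^-1|^(e f). *)
Lemma haar_disk (c x : K) : x != 0 -> vK x <= 1 ->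
  mu (vdisk vK c (vK x)) = (vK x ^+ (e * f))%:E.
Proof.
move=> x0 x1; have [l ->] := value_le1 x0 x1.
rewrite exprAC absval_uniformizer_pow.
pose rep (i : 'I_#|{ffun 'I_f -> 'I_p}|) := digit_sum gamma (enum_val i).
have qE : #|{ffun 'I_f -> 'I_p}| = (p ^ f)%N by rewrite card_ffun !card_ord.
rewrite (@measure_vdisk _ _ _ _ _ rep) ?absval_uniformizer_gt0 ?absval_uniformizer_lt1//.
- by rewrite qE exprVn.
- move=> y y1; rewrite absval_uniformizer.
  exact: (absval_lt1_uniformizer p_prime QpP eE beta_abs).
- by move=> i; exact: (digit_sum_le1 vKQ gamma_prim).
- move=> i j /(digit_sum_inj p_prime QpP vKQ eE fE gamma_prim) ij.
  exact: enum_val_inj.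
- move=> y /(digit_sum_ex p_prime QpP vKQ eE fE gamma_prim)[a ya].
  by exists (enum_rank a); rewrite /rep enum_rankK.
- by rewrite vdisk0.
Qed.

Lemma Zset_code : exists code : K -> nat,
  {in Zset p e f gamma beta &, injective code}.
Proof.
pose g (x : nat * nat) : Qp := x.2%:R * p%:R ^- x.1.
have /choice[M MP] (z : K) : exists M : 'M[nat * nat]_(e, f),
    Zset p e f gamma beta z -> z = lincomb gamma beta (map_mx g M).
  have [[B BX zB]|nZ] := pselect (Zset p e f gamma beta z); last first.
    by exists (const_mx (0%N, 0%N)) => /nZ.
  have /choice[h hP] (ij : 'I_e * 'I_f) : exists x, B ij.1 ij.2 = g x.
    by have [k [n [_ Bkn]]] := Xset_nat p_prime QpP (BX ij.1 ij.2); exists (k, n).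
  exists (\matrix_(i, j) h (i, j)) => _; rewrite zB; congr lincomb.
  by apply/matrixP => i j; rewrite !mxE -hP.
exists (fun z => pickle (M z)) => z z' /set_mem zZ /set_mem z'Z.
by move=> /(pcan_inj pickleK) MM; rewrite (MP z zZ) (MP z' z'Z) MM.
Qed.

End haar_measure.

Theorem theorem28 (R : realType) (p : nat) (p_prime : prime p)
    (Qp : fieldType) (vQ : absvalue R Qp) (QpP : is_Qp p vQ)
    (K : fieldExtType Qp) (vK : absvalue R K)
    (vKQ : forall x : Qp, vK x%:A = vQ x)
    (m e f : nat) (mE : m = \dim {:K})
    (eE : ramification_index vQ vK {:K}%AS e)
    (fE : residue_degree vQ vK {:K}%AS f)
    (L : {subfield K}) (L_unram : ramification_index vQ vK L 1)
    (L_dim : \dim L = f)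
    (gamma : K) (gamma_prim : (p ^ f - 1)%N.-primitive_root gamma)
    (gammaL : <<1; gamma>>%VS = L)
    (beta : K) (betaK : <<L; beta>>%VS = {:K}%VS)
    (beta_abs : vK beta = p%:R `^ (e%:R^-1))
    (mu : {measure set (borel vK) -> \bar R}) (mu_haar : is_haar mu)
    (mu_ball : mu [set x : K | vK x < 1] = 1%E)
    (a b : nat -> nat)
    (a_gt0 : forall n, (0 < n)%N -> (0 < a n)%N)
    (b_gt0 : forall n, (0 < n)%N -> (0 < b n)%N)
    (ab_stoltz : stoltz (R := R) a b) :
  let c := partial_quotient p vQ e f gamma beta in
  let q : R := (p ^ f)%:R in
  let freq (P : pred K) (alpha : K) (n : nat) : R :=
    frequency (fun k => P (c k alpha)) (a n) (b n) in
  [/\ {ae mu, forall alpha : K, vK alpha < 1 ->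
        forall z, Zstar p vK e f gamma beta z ->
        freq (fun x => x == z) alpha n @[n --> \oo] --> (vK z ^+ (2 * m))^-1},
      {ae mu, forall alpha : K, vK alpha < 1 ->
        (b n)%:R^-1 *
          (\sum_(1 <= j < (b n).+1) - valuation p vK (c (a n + j)%N alpha))
          @[n --> \oo] --> q / ((q - 1) * e%:R)},
      {ae mu, forall alpha : K, vK alpha < 1 ->
        forall l : nat, (0 < l)%N ->
        freq (fun x => vK x == p%:R `^ (l%:R / e%:R)) alpha n @[n --> \oo]
          --> (q - 1) / (p ^ (f * l))%:R /\
        freq (fun x => p%:R `^ (l%:R / e%:R) <= vK x) alpha n @[n --> \oo]
          --> ((p ^ (f * (l - 1)))%:R^-1 : R)} &
      {ae mu, forall alpha : K, vK alpha < 1 ->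
        forall k l : nat, (0 < k)%N -> (k < l)%N ->
        freq (fun x => p%:R `^ (k%:R / e%:R) <= vK x < p%:R `^ (l%:R / e%:R))
          alpha n @[n --> \oo]
          --> ((p ^ (f * (k - 1)))%:R^-1
                * (1 - (p ^ (f * (l - k)))%:R^-1) : R)}].
Proof.
move=> c q freq.
have mE' : m = (e * f)%N by rewrite mE (dim_extension p_prime QpP vKQ eE fE gamma_prim beta_abs).
have e0 := ramification_gt0 eE; have f0 := residue_gt0 fE.
have m0 : (0 < m)%N by rewrite mE' muln_gt0 e0.
have u0 := absval_uniformizer_gt0 p_prime eE beta_abs.
have u1 := absval_uniformizer_lt1 p_prime eE beta_abs.
have muB (x y : K) : y != 0 -> vK y <= 1 -> mu (vdisk vK x (vK y)) = (vK y ^+ m)%:E.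
  rewrite mE'; exact: (haar_disk p_prime QpP vKQ eE fE gamma_prim beta_abs mu_haar mu_ball).
pose fl := Defs.floorK p vQ e f gamma beta.
have flP x : Zset p e f gamma beta (fl x) /\ vK (x - fl x) < 1.
  exact: (floorKP p_prime QpP vKQ eE fE gamma_prim beta_abs).
have flZ x : Zset p e f gamma beta (fl x) by case: (flP x).
have fl1 x : vK (x - fl x) < 1 by case: (flP x).
have flD z y : Zset p e f gamma beta z -> vK y < 1 -> fl (z + y) = z.
  exact: (floorKD p_prime QpP vKQ eE fE gamma_prim beta_abs).
have [code codeI] := Zset_code p_prime QpP e f gamma beta.
have [|zs [zsZ zs_surj zs_inj]] := @code_enumeration _ (Zstar p vK e f gamma beta) code.
  by move=> z z' /set_mem[zZ _] /set_mem[z'Z _]; apply: codeI; apply/mem_set.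
have q1 : 1 < q by rewrite /q ltr1n -(exp1n f) ltn_exp2r// prime_gt1.
have uq : vK beta^-1 ^+ m = q^-1.
  by rewrite mE' (absval_uniformizer_pow f eE beta_abs).
have vd := value_lt1 p_prime QpP eE beta_abs.
have freqE (A : pred K) x n : freq A x n
    = cf_sum fl (fun y => (A y)%:R) (b n) (iter (a n) (cf_step fl) x) / (b n)%:R.
  exact: frequency_cf_sum.
have bE l : p%:R `^ (l%:R / e%:R) = vK beta^-1 ^- l.
  rewrite absvalV beta_abs exprVn invrK -powR_mulrn ?powR_ge0//.
  by rewrite -powRrM mulrC.
have aeS := @filterS _ _ (ae_filter_ringOfSetsType mu).
(* Both (iii) and (iv) follow, on this one set of full measure, by subtracting tail frequencies. *)
have level := cf_level_frequency m0 u0 u1 muB flZ fl1 flD zsZ zs_surj zs_inj uq vd ab_stoltz.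
pose A l (y : K) : bool := vK beta^-1 ^- l <= vK y.
have qX k : q ^- k = (p ^ (f * k))%:R^-1 by rewrite expnM natrX.
have levelE l x n : freq (fun y => p%:R `^ (l%:R / e%:R) <= vK y) x n
    = cf_sum fl (fun y => (A l y)%:R) (b n) (iter (a n) (cf_step fl) x) / (b n)%:R.
  by rewrite freqE bE.
split.
(* Indexing by i instead of z leaves a countable union of null sets; indices with zs i = 0 code no
   digit. *)
- suff : {ae mu, forall x i, vK x < 1 -> zs i != 0 ->
      freq (fun x => x == zs i) x n @[n --> \oo] --> (vK (zs i) ^+ (2 * m))^-1}.
    apply: aeS => x xP x1 z /[dup] [[_ z1]] /zs_surj[i iz].
    rewrite -iz; apply: xP => //.
    by rewrite iz -(absval_gt0 vK) (lt_trans ltr01).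
  apply: ae_foralln => i; have [zi0|zi0] := eqVneq (zs i) 0.
    by apply: aeW => x _ /eqP; rewrite zi0.
  have := cf_digit_frequency m0 u0 u1 muB flZ fl1 flD zsZ zs_surj zs_inj ab_stoltz zi0.
  by apply: aeS => x xP x1 _; under eq_cvg do rewrite freqE; exact: xP.
- have := cf_level_average m0 u0 u1 muB flZ fl1 flD zsZ zs_surj zs_inj q1 uq vd ab_stoltz.
  (* Levels count in steps of 1/e because |beta| = p^(1/e); this is the factor e in the limit. *)
  have valE (y : K) : - valuation p vK y = cf_level vK beta^-1 y / e%:R.
    rewrite /valuation /cf_level opprK absvalV beta_abs lnV ?posrE ?powR_gt0 ?ltr0n ?prime_gt0//.
    rewrite ln_powR; have lnp : ln (p%:R : R) != 0.
      by rewrite gt_eqF// ln_gt0// ltr1n prime_gt1.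
    have eR : e%:R != 0 :> R by rewrite pnatr_eq0 -lt0n.
    by move: (ln (vK y)) (ln p%:R) lnp => U V V0; field; rewrite V0 eR.
  apply: aeS => x xP x1; rewrite invfM mulrA.
  rewrite (_ : (fun n => _) = fun n => cf_sum fl (cf_level vK beta^-1) (b n)
      (iter (a n) (cf_step fl) x) / (b n)%:R / e%:R).
    by apply: cvgMl; exact: xP.
  apply/funext => n; rewrite [RHS]mulrAC [RHS]mulrC; congr (_ * _).
  rewrite big_add1 big_mkord /cf_sum mulr_suml; apply: eq_bigr => j _.
  by rewrite valE /c /partial_quotient addnS /= addnC iterD.
- apply: aeS level => x xP x1 l l0.
  have xl k : (0 < k)%N -> freq (fun y => p%:R `^ (k%:R / e%:R) <= vK y) x n
      @[n --> \oo] --> q ^- k.-1.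
    by move=> k0; under eq_cvg do rewrite levelE; exact: xP.
  split; last by rewrite subn1 -qX; exact: xl.
  (* Absolute value exactly p^(l/e) means reaching level l but not l + 1, so the limit is a
     difference of two tails. *)
  rewrite (_ : (q - 1) / _ = q ^- l.-1 - q ^- l.+1.-1); last first.
    have q0 : q != 0 by rewrite gt_eqF// (lt_trans ltr01).
    rewrite -qX /= -{1 3}(prednK l0) exprS; field.
    by rewrite q0 expf_neq0.
  rewrite (_ : (fun n => _) = fun n => freq (fun y => p%:R `^ (l%:R / e%:R) <= vK y) x n
      - freq (fun y => p%:R `^ (l.+1%:R / e%:R) <= vK y) x n).
    by apply: cvgB; exact: xl.
  apply/funext => n; rewrite !levelE freqE -mulrBl -cf_sumB; congr (cf_sum _ _ _ _ / _).
  apply/funext => y; rewrite bE (value_eq_level p_prime QpP eE beta_abs) -!/(A _ _).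
  have := @value_level_mono _ _ p_prime _ _ _ _ _ eE _ beta_abs l l.+1 y (leqnSn l).
  rewrite -!/(A _ _); case: (A l.+1 y) => [->|_]//; first by rewrite subrr.
  by rewrite andbT subr0.
- apply: aeS level => x xP x1 k l k0 kl.
  have l0 : (0 < l)%N by exact: leq_ltn_trans kl.
  have xl i : (0 < i)%N -> freq (fun y => p%:R `^ (i%:R / e%:R) <= vK y) x n
      @[n --> \oo] --> q ^- i.-1.
    by move=> i0; under eq_cvg do rewrite levelE; exact: xP.
  rewrite (_ : _ * (1 - _) = q ^- k.-1 - q ^- l.-1); last first.
    rewrite -!qX mulrBr mulr1 subn1; congr (_ - _).
    by rewrite -invfM -exprD; congr (_ ^- _); lia.
  rewrite (_ : (fun n => _) = fun n => freq (fun y => p%:R `^ (k%:R / e%:R) <= vK y) x n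
      - freq (fun y => p%:R `^ (l%:R / e%:R) <= vK y) x n).
    by apply: cvgB; exact: xl.
  apply/funext => n; rewrite !levelE freqE -mulrBl -cf_sumB; congr (cf_sum _ _ _ _ / _).
  apply/funext => y; rewrite !bE ltNge -!/(A _ _).
  have := @value_level_mono _ _ p_prime _ _ _ _ _ eE _ beta_abs k l y (ltnW kl).
  rewrite -!/(A _ _); case: (A l y) => [->|_]//; first by rewrite subrr.
  by rewrite andbT subr0.
Qed.
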